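(* For every $n$ there is a simple arrangement $\mathcal{L}$ of $n$ lines in the plane such that every subset of $\mathcal{L}$ of size $n^{5/6+o(1)}$ (with $o(1)\to 0$ as $n\to\infty$) contains all the lines bounding some cell of the arrangement. In particular, the chromatic number of the hypergraph $\mathcal{H}_{\text{line-cell}}$ of this arrangement is at least $n^{1/6-o(1)}$.
   Context: A simple arrangement of a finite set $\mathcal{L}$ of lines in $\mathbb{R}^2$ is one with no two parallel lines and no three lines through a common point. Its cells are the connected components of $\mathbb{R}^2\setminus\bigcup_{\ell\in\mathcal{L}}\ell$. The hypergraph $\mathcal{H}_{\text{line-cell}}$ has vertex set $\mathcal{L}$ and, for each cell, a hyperedge consisting of the lines that contain a boundary edge of that cell. The chromatic number of a hypergraph is the minimum number of colors in a vertex coloring with no monochromatic hyperedge. *)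

(* Defs.v *)
From Stdlib Require Import Reals Lra List.
Import ListNotations.
Open Scope R_scope.

Record line := mkLine { la : R; lb : R; lc : R; line_nondeg : la <> 0 \/ lb <> 0 }.

Definition pt := (R * R)%type.

Definition on_line (l : line) (p : pt) : Prop :=
  la l * fst p + lb l * snd p = lc l.

Definition dflt_line : line := mkLine 1 0 0 (or_introl R1_neq_R0).

Definition lin (L : list line) (i : nat) : line := nth i L dflt_line.

Definition parallel (l m : line) : Prop := la l * lb m - la m * lb l = 0.

Definition simple_arr (L : list line) : Prop :=
  (forall i j, (i < length L)%nat -> (j < length L)%nat -> i <> j ->
     ~ parallel (lin L i) (lin L j)) /\
  (forall i j k p, (i < length L)%nat -> (j < length L)%nat -> (k < length L)%nat ->
     i <> j -> j <> k -> i <> k ->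
     ~ (on_line (lin L i) p /\ on_line (lin L j) p /\ on_line (lin L k) p)).

Definition off_lines (L : list line) (p : pt) : Prop :=
  forall i, (i < length L)%nat -> ~ on_line (lin L i) p.

(* q lies in the same connected component (= path component, the set being
   open) of R^2 \ union L as p *)
Definition same_cell (L : list line) (p q : pt) : Prop :=
  off_lines L p /\ off_lines L q /\
  exists g : R -> pt,
    continuity (fun t => fst (g t)) /\ continuity (fun t => snd (g t)) /\
    g 0 = p /\ g 1 = q /\ (forall t, 0 <= t <= 1 -> off_lines L (g t)).

Definition in_closure_cell (L : list line) (p z : pt) : Prop :=
  forall eps, 0 < eps -> exists q, same_cell L p q /\
    Rabs (fst q - fst z) < eps /\ Rabs (snd q - snd z) < eps.

(* line i contains a boundary edge of the cell containing p: a nondegenerate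
   segment of line i lies in the closure of the cell (the cell is open and
   disjoint from the line, so this segment lies on the cell's boundary) *)
Definition bounds_cell (L : list line) (i : nat) (p : pt) : Prop :=
  exists a b : pt, a <> b /\ on_line (lin L i) a /\ on_line (lin L i) b /\
    forall t, 0 <= t <= 1 ->
      in_closure_cell L p (fst a + t * (fst b - fst a), snd a + t * (snd b - snd a)).

(* the hyperedge of the cell containing p (p off all lines) is contained in S *)
Definition hyperedge_in (L : list line) (p : pt) (S : nat -> Prop) : Prop :=
  forall i, (i < length L)%nat -> bounds_cell L i p -> S i.

Definition proper_coloring (L : list line) (k : nat) (col : nat -> nat) : Prop :=
  (forall i, (i < length L)%nat -> (col i < k)%nat) /\
  forall p, off_lines L p -> ~ exists c, hyperedge_in L p (fun i => col i = c).

(* Main.v *)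
(** Collinear triples of the integer grid [[n]^3] are plentiful: a set [A] of
    density [d] splits, in each of the about [(d n)^3] short primitive
    directions, into boundedly long pieces of lines, so most of [A] can be packed
    by disjoint collinear triples in that direction.  Two points determine their
    direction, so the union of these packings is a _linear_ 3-uniform hypergraph
    that is nearly regular.  For such a hypergraph a two-stage greedy fingerprint
    (first a graph of bounded degree made of links of vertices of [I], then
    neighbourhoods in that graph) captures each line-free set [I] in a container
    that misses a fixed proportion of [A].  With [n = q^3], iterating down to size
    [O(q^8)] costs fingerprints of length [O(q^5)] up to logarithms.

    A random choice of about [q^6] grid points contains few collinear quadruples,
    and, by the union bound over containers, no line-free set of size [q^5] up to
    logarithms.  After deleting the quadruples, each larger set contains a
    collinear triple whose line carries no further chosen point.

    Projecting generically to the plane and dualising turns such triples into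
    points lying on exactly three lines.  Moving the line of slope [x] by
    [e * x^2] makes the arrangement simple, and each of these points opens into
    a small triangle that no other line meets. *)
Require Import Defs.
From Stdlib Require Import Reals Lra List ZArith Lia Classical.
From mathcomp Require all_boot zify.
Open Scope R_scope.

Definition zpoint := (Z * Z * Z)%type.
Definition collinear (p q r : zpoint) : Prop :=
  let '(p1, p2, p3) := p in let '(q1, q2, q3) := q in let '(r1, r2, r3) := r in
  ((q1 - p1) * (r2 - p2) = (q2 - p2) * (r1 - p1))%Z /\
  ((q1 - p1) * (r3 - p3) = (q3 - p3) * (r1 - p1))%Z /\
  ((q2 - p2) * (r3 - p3) = (q3 - p3) * (r2 - p2))%Z.

Module GridTriples.

Import all_boot zify.
Set Implicit Arguments. Unset Strict Implicit. Unset Printing Implicit Defensive.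
Local Open Scope nat_scope.

(** * Containers for linear triple systems *)

Definition section (T U : finType) (B : {set T * U}) (x : T) : {set U} :=
  [set y | (x, y) \in B].

Lemma card_section (T U : finType) (B : {set T * U}) :
  #|B| = \sum_x #|section B x|.
Proof.
rewrite -sum1_card big_mkcond /=.
rewrite (eq_bigr (fun p : T * U => if (p.1, p.2) \in B then 1 else 0)); last by case.
rewrite -(pair_bigA _ (fun x y => if (x, y) \in B then 1 else 0)) /=.
apply: eq_bigr => x _; rewrite -sum1_card -big_mkcond /=.
by apply: eq_bigl => y; rewrite inE.
Qed.

Lemma leq_card_section (T U : finType) (B : {set T * U}) (X : {set T}) (a b : nat) :
  (forall x y, (x, y) \in B -> x \in X) ->
  (forall x, x \in X -> b * #|section B x| <= a) -> b * #|B| <= #|X| * a.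
Proof.
move=> BX le_a; rewrite card_section big_distrr /=.
rewrite -sum_nat_const (bigID (mem X)) /= addnC big1 ?add0n => [|x xX].
  by apply: leq_sum => x xX; apply: le_a.
rewrite (_ : section B x = set0) ?cards0 ?muln0 //.
by apply/setP => y; rewrite !inE; apply: contraNF xX => /BX.
Qed.

(** The head of [s] is the vertex chosen last: its gain is measured against what the tail has
    collected. The result depends on [s] alone, which is what makes containers countable. *)
Definition grow (T U : finType) (gain : {set U} -> T -> {set U}) (s : seq T) : {set U} :=
  foldr (fun v G => G :|: gain G v) set0 s.

(** While some [v] in [I] gains at least [a / b] elements, it is put in front of [s]. Gains are
    disjoint from what is already there, so the process ends and the length of [s] is paid for by
    the size of the collected set. *)
Lemma greedy_fingerprint (T U : finType) (gain : {set U} -> T -> {set U})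
    (a b : nat) (I : {set T}) :
  (forall (G : {set U}) v, [disjoint G & gain G v]) -> 0 < a ->
  exists s, [/\ {subset s <= I}, a * size s <= b * #|grow gain s| &
    forall v, v \in I -> b * #|gain (grow gain s) v| < a].
Proof.
move=> dis a0.
suff H d s : {subset s <= I} -> a * size s <= b * #|grow gain s| ->
    b * #|U| < b * #|grow gain s| + d -> exists s, [/\ {subset s <= I},
    a * size s <= b * #|grow gain s| &
    forall v, v \in I -> b * #|gain (grow gain s) v| < a].
  by apply: (H (b * #|U|).+1 [::]) => //=; [rewrite muln0 | rewrite cards0; lia].
elim: d s => [|d IH] s sI hs hd.
  have : b * #|grow gain s| <= b * #|U| by rewrite leq_mul2l max_card orbT.
  by lia.
case: (boolP [exists v in I, a <= b * #|gain (grow gain s) v|]) => [|no]; last first.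
  exists s; split => // v vI; rewrite ltnNge; apply: contra no => h.
  by apply/existsP; exists v; rewrite vI.
case/existsP => v /andP[vI h].
have E : #|grow gain (v :: s)| = #|grow gain s| + #|gain (grow gain s) v|.
  by rewrite /= cardsU disjoint_setI0 // cards0 subn0.
apply: (IH (v :: s)) => [w||].
- by rewrite inE => /orP[/eqP-> //|/sI].
- by rewrite E mulnS mulnDr addnC leq_add.
- by rewrite E mulnDr; move: hd h a0; lia.
Qed.

Definition saturated (T : finType) (D : nat) (G : {set T * T}) : {set T} :=
  [set x | D <= #|section G x|].

Definition new_pairs (T : finType) (E : {set T * (T * T)}) (D : nat)
    (G : {set T * T}) (v : T) : {set T * T} :=
  [set p in section E v | [&& p \notin G, p.1 \notin saturated D G
                            & p.2 \notin saturated D G]].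

Definition new_nbrs (T : finType) (G : {set T * T}) (W : {set T}) (u : T) : {set T} :=
  section G u :\: W.

(** A linear 3-uniform hypergraph stored as ordered triples; with the shape [(v, (x, y))], the
    section at [v] is the link of [v]. Linearity is [lt_inj]: two points determine the third. *)
Record linear_triples (T : finType) (A : {set T}) (E : {set T * (T * T)}) : Prop := {
  lt_supp : forall v x y, (v, (x, y)) \in E -> v \in A;
  lt_swap : forall v x y, (v, (x, y)) \in E -> (x, (v, y)) \in E;
  lt_swap2 : forall v x y, (v, (x, y)) \in E -> (v, (y, x)) \in E;
  lt_inj : forall v w p, (v, p) \in E -> (w, p) \in E -> v = w }.

Lemma grow_pairs_sub (T : finType) (E : {set T * (T * T)}) (D : nat) s x y :
  (x, y) \in grow (new_pairs E D) s -> exists2 v, v \in s & (v, (x, y)) \in E.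
Proof.
elim: s => [|v s IH] /=; first by rewrite inE.
rewrite inE => /orP[/IH[w ws wE]|]; first by exists w; rewrite ?inE ?ws ?orbT.
by rewrite !inE => /andP[vE _]; exists v; rewrite ?inE ?eqxx.
Qed.

Lemma grow_pairs_sym (T : finType) (A : {set T}) (E : {set T * (T * T)}) (D : nat) s x y :
  linear_triples A E ->
  (x, y) \in grow (new_pairs E D) s -> (y, x) \in grow (new_pairs E D) s.
Proof.
move=> lin; elim: s x y => [|v s IH] x y /=; first by rewrite inE.
set G := grow _ s in IH *.
have symG a b : ((a, b) \in G) = ((b, a) \in G) by apply/idP/idP; apply: IH.
rewrite in_setU => /orP[/IH h|]; first by rewrite in_setU h.
rewrite in_setU => h; apply/orP; right; move: h.
rewrite !in_set /= symG => /andP[/(lt_swap2 lin)-> /and3P[-> h1 h2]] /=.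
by rewrite h1 h2.
Qed.

(** By linearity [v] and [x] determine the third point, so the link of [v] raises the degree of [x]
    by at most one, and not at all once [x] is saturated. *)
Lemma grow_pairs_deg (T : finType) (A : {set T}) (E : {set T * (T * T)}) (D : nat) s x :
  linear_triples A E -> 0 < D -> #|section (grow (new_pairs E D) s) x| <= D.
Proof.
move=> lin D0; elim: s => [|v s IH] /=.
  by rewrite (_ : section _ _ = set0) ?cards0 //; apply/setP => y; rewrite !inE.
set G := grow _ s in IH *.
have -> : section (G :|: new_pairs E D G v) x = section G x :|: section (new_pairs E D G v) x.
  by apply/setP => y; rewrite !in_set.
case: (leqP D #|section G x|) => hD.
  rewrite (_ : section (new_pairs E D G v) x = set0) ?setU0 //.
  by apply/setP => y; rewrite !in_set /= hD !andbF.
apply: (leq_trans (leq_card_setU _ _)).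
suff : #|section (new_pairs E D G v) x| <= 1 by lia.
apply/card_le1_eqP => y y'.
rewrite !in_set => /andP[h _] /andP[h' _].
apply: (lt_inj lin (p := (v, x))).
  by apply: (lt_swap lin); apply: (lt_swap2 lin).
by apply: (lt_swap lin); apply: (lt_swap2 lin).
Qed.

(* The two cores below contain [I] when [s] is a greedy fingerprint of [I], but
   depend on [I] only through [s]. *)
Definition dense_core (T : finType) (A : {set T}) E (Q D : nat) (s : seq T) : {set T} :=
  [set v in A | 4 * #|new_pairs E D (grow (new_pairs E D) s) v| < Q].

Definition graph_core (T : finType) (A : {set T}) (G : {set T * T}) (D : nat)
    (s : seq T) : {set T} :=
  [set v in A :\: grow (new_nbrs G) s | 24 * #|new_nbrs G (grow (new_nbrs G) s) v| < D].

(** When the core is nearly all of [A], most triples are blocked: their pair is already in [G] or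
    meets a saturated point. Both cases need many pairs in [G], since a saturated point accounts for
    at least [D] of them. *)
Lemma dense_core_graph (T : finType) (A : {set T}) (E : {set T * (T * T)}) (Q D : nat) s :
  linear_triples A E -> (forall v, #|section E v| <= 2 * Q) -> Q * #|A| <= #|E| ->
  0 < D -> D <= 2 * Q -> 8 * #|A :\: dense_core A E Q D s| < #|A| ->
  D * #|A| <= 12 * #|grow (new_pairs E D) s|.
Proof.
move=> lin link_le E_ge D0 DQ.
rewrite /dense_core; set G := grow _ s; set C := [set v in A | _] => few.
pose S := saturated D G.
(* A triple has a pair still available at a core vertex ([E1]), a pair already in [G] ([E2]), a
   saturated point in its pair ([E3], [E4]), or its first point outside the core ([E5]). *)
pose E1 := [set e in E | (e.1 \in C) && (e.2 \in new_pairs E D G e.1)].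
pose E2 := [set e in E | e.2 \in G].
pose E3 := [set e in E | e.2.1 \in S].
pose E4 := [set e in E | e.2.2 \in S].
pose E5 := [set e in E | e.1 \in A :\: C].
have cov : E \subset E1 :|: E2 :|: E3 :|: E4 :|: E5.
  apply/subsetP => -[v [x y]] vE; have vA := lt_supp lin vE.
  rewrite !(in_setU, in_set) /= vE vA /=.
  by case: (_ < Q) => //=; rewrite ?orbT //;
     case: (_ \in G) => //=; case: (D <= _) => //=; rewrite ?orbT //; case: (D <= _).
have hE1 : 4 * #|E1| <= #|C| * Q.
  apply: leq_card_section => [v p|v vC]; first by rewrite !in_set => /and3P[].
  move: (vC); rewrite in_set => /andP[_ h]; apply: leq_trans (ltnW h).
  rewrite leq_mul2l; apply/orP; right; apply: subset_leq_card.
  by apply/subsetP => p; rewrite !in_set => /and3P[].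
have hE2 : #|E2| <= #|G|.
  have inj : {in E2 &, injective snd}.
    move=> [v p] [w p']; rewrite !in_set /= => /andP[h _] /andP[h' _] e.
    by rewrite -e in h' *; rewrite (lt_inj lin h h').
  rewrite -(card_in_imset inj); apply: subset_leq_card.
  by apply/subsetP => _ /imsetP[[v p] + ->]; rewrite in_set => /andP[].
have hS (F : {set T * (T * T)}) : (forall v p, (v, p) \in F -> (v, p) \in E /\ v \in S) ->
    #|F| <= #|S| * (2 * Q).
  move=> hF; rewrite -[#|F|]mul1n; apply: leq_card_section => [v p /hF[]//|v vS].
  rewrite mul1n; apply: leq_trans (link_le v); apply: subset_leq_card.
  by apply/subsetP => p; rewrite !in_set => /hF[].
pose f1 (e : T * (T * T)) := (e.2.1, (e.1, e.2.2)).
pose f2 (e : T * (T * T)) := (e.2.2, (e.1, e.2.1)).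
have hE3 : #|E3| <= #|S| * (2 * Q).
  have inj : injective f1 by move=> [v [x y]] [v' [x' y']] [-> -> ->].
  rewrite -(card_imset _ inj); apply: hS => v p /imsetP[[w [x y]]].
  by rewrite in_set /= => /andP[h hx] [-> ->]; rewrite (lt_swap lin h).
have hE4 : #|E4| <= #|S| * (2 * Q).
  have inj : injective f2 by move=> [v [x y]] [v' [x' y']] [-> -> ->].
  rewrite -(card_imset _ inj); apply: hS => v p /imsetP[[w [x y]]].
  rewrite in_set /= => /andP[h hx] [-> ->].
  by rewrite (lt_swap lin (lt_swap2 lin h)).
have hE5 : #|E5| <= #|A :\: C| * (2 * Q).
  rewrite -[#|E5|]mul1n; apply: leq_card_section => [v p|v vS].
    by rewrite in_set => /andP[].
  rewrite mul1n; apply: leq_trans (link_le v); apply: subset_leq_card.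
  by apply/subsetP => p; rewrite !in_set => /andP[].
have hSG : #|S| * D <= #|G|.
  have -> : #|G| = \sum_x #|section G x| by apply: card_section.
  rewrite [leqRHS](bigID (mem S)) /= -sum_nat_const.
  by apply: leq_trans (leq_addr _ _); apply: leq_sum => x; rewrite in_set.
have hCA : #|C| <= #|A|.
  by apply: subset_leq_card; apply/subsetP => x; rewrite in_set => /andP[].
have tot : #|E| <= #|E1| + #|E2| + #|E3| + #|E4| + #|E5|.
  apply: leq_trans (subset_leq_card cov) _.
  apply: leq_trans (leq_card_setU _ _) _; rewrite leq_add2r.
  apply: leq_trans (leq_card_setU _ _) _; rewrite leq_add2r.
  apply: leq_trans (leq_card_setU _ _) _; rewrite leq_add2r.
  by apply: leq_trans (leq_card_setU _ _) _.
(* [E1] and [E5] each hold at most a quarter of [Q * #|A|], so half of it falls to [G] and the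
   saturated points; [D <= 2 * Q] and [D * #|S| <= #|G|] turn this into [12 = 4 + 8]. *)
have a1 : 4 * #|E1| <= #|A| * Q by nia.
have a5 : 4 * #|E5| <= Q * #|A| by nia.
have a2 : Q * #|A| <= 2 * #|G| + 8 * Q * #|S| by nia.
have a3 : D * (Q * #|A|) <= 4 * Q * #|G| + 8 * Q * (D * #|S|) by nia.
have a4 : Q * (D * #|A|) <= Q * (12 * #|G|) by nia.
have Q0 : 0 < Q by lia.
by rewrite leq_pmul2l in a4.
Qed.

(** A pair of [G] starts outside the core, ends in [W], or is one of fewer than [D / 24] new pairs
    at a core vertex. The last kind makes up at most half of [G], and [W] is itself cut out of the
    core. *)
Lemma graph_core_small (T : finType) (A : {set T}) (G : {set T * T}) (D : nat) s :
  (forall x y, (x, y) \in G -> (y, x) \in G) ->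
  (forall x y, (x, y) \in G -> x \in A) ->
  (forall x, #|section G x| <= D) -> 0 < D -> D * #|A| <= 12 * #|G| ->
  #|A| <= 48 * #|A :\: graph_core A G D s|.
Proof.
move=> sym GA deg D0 big.
rewrite /graph_core; set W := grow _ s; set C := [set v in _ | _].
pose G1 := [set e in G | e.1 \in A :\: C].
pose G2 := [set e in G | e.2 \in W].
pose G3 := [set e in G | (e.1 \in C) && (e.2 \notin W)].
have WA : W \subset A.
  apply/subsetP => x; rewrite /W; elim: s {W C G1 G2 G3} => [|u s IH] /=; first by rewrite inE.
  by rewrite !in_set => /orP[//|/andP[_ /sym /GA]].
have cov : G \subset G1 :|: G2 :|: G3.
  apply/subsetP => -[x y] xyG; have xA := GA _ _ xyG.
  rewrite !in_setU in_set [_ \in A :\: C]in_setD xyG xA /= andbT.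
  rewrite !(in_set _ (_, _)) /= xyG /=.
  by case: (x \in C) => //=; rewrite orbN.
have hD (F : {set T * T}) (X : {set T}) :
    (forall x y, (x, y) \in F -> (x, y) \in G /\ x \in X) -> #|F| <= #|X| * D.
  move=> hF; rewrite -[#|F|]mul1n; apply: leq_card_section => [v p /hF[]//|v vS].
  rewrite mul1n; apply: leq_trans (deg v); apply: subset_leq_card.
  by apply/subsetP => p; rewrite !in_set => /hF[].
have h1 : #|G1| <= #|A :\: C| * D.
  by apply: hD => x y; rewrite in_set => /andP[].
have h2 : #|G2| <= #|W| * D.
  pose f (e : T * T) := (e.2, e.1).
  have inj : injective f by move=> [x y] [x' y'] [-> ->].
  rewrite -(card_imset _ inj); apply: hD => x y /imsetP[[a b]].
  by rewrite in_set /= => /andP[h hx] [-> ->]; rewrite (sym _ _ h).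
have h3 : 24 * #|G3| <= #|C| * D.
  apply: leq_card_section => [x y|x xC]; first by rewrite in_set => /and3P[].
  move: (xC); rewrite in_set => /andP[_ h]; apply: leq_trans (ltnW h).
  rewrite leq_mul2l; apply/orP; right; apply: subset_leq_card.
  by apply/subsetP => p; rewrite !in_set => /and3P[-> _ ->].
have tot : #|G| <= #|G1| + #|G2| + #|G3|.
  apply: leq_trans (subset_leq_card cov) _.
  apply: leq_trans (leq_card_setU _ _) _; rewrite leq_add2r.
  by apply: leq_trans (leq_card_setU _ _) _.
have hW : #|W| <= #|A :\: C|.
  apply: subset_leq_card; apply/subsetP => x xW.
  by rewrite in_setD in_set in_setD xW /= (subsetP WA).
have hC : #|C| <= #|A|.
  by apply: subset_leq_card; apply/subsetP => x; rewrite !in_set => /andP[/andP[]].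
rewrite -(leq_pmul2l D0); nia.
Qed.

(** Padding by [None] encodes lists of length at most [t] as words over [#|T| + 1] letters, which
    bounds the number of fingerprints. *)
Lemma bounded_seq_tuple (T : finType) (t : nat) (s : seq T) :
  size s <= t -> exists u : t.-tuple (option T), s = pmap id u.
Proof.
move=> st; have sz : size (map Some s ++ nseq (t - size s) None) == t.
  by rewrite size_cat size_map size_nseq subnKC.
exists (Tuple sz); rewrite /= pmap_cat -[LHS]cats0; congr (_ ++ _).
  by elim: s {st sz} => //= x s <-.
by elim: (t - _).
Qed.

(** The two hypotheses on [t] bound the fingerprints: each vertex of the first adds at least [Q / 4]
    pairs to a graph with at most [#|A| * D] pairs, each vertex of the second at least [D / 24]
    points of [A]. *)
Lemma container_step (T : finType) (A : {set T}) (E : {set T * (T * T)}) (Q D t : nat) :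
  linear_triples A E -> (forall v, #|section E v| <= 2 * Q) -> Q * #|A| <= #|E| ->
  0 < D -> D <= 2 * Q -> 4 * #|A| * D <= Q * t -> 24 * #|A| <= D * t ->
  exists F : {set {set T}}, [/\ #|F| <= #|T|.+1 ^ (2 * t),
    forall C, C \in F -> 48 * #|C| <= 47 * #|A| &
    forall I : {set T}, I \subset A ->
      (forall v x y, v \in I -> x \in I -> y \in I -> (v, (x, y)) \notin E) ->
      exists2 C, C \in F & I \subset C].
Proof.
move=> lin link_le E_ge D0 DQ hs1 hs2.
have Q0 : 0 < Q by lia.
pose G s := grow (new_pairs E D) s.
(* If the dense core already misses an eighth of [A], it is the container; otherwise the graph is
   dense and its core is used. *)
pose cont s1 s2 := if 8 * #|A :\: dense_core A E Q D s1| < #|A|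
  then graph_core A (G s1) D s2 else dense_core A E Q D s1.
pose seqs := ((t.-tuple (option T)) * (t.-tuple (option T)))%type.
pose F := [set cont (pmap id u.1) (pmap id u.2) | u : seqs].
have symG s x y : (x, y) \in G s -> (y, x) \in G s by apply: grow_pairs_sym lin.
have GA s x y : (x, y) \in G s -> x \in A.
  by case/grow_pairs_sub => v _ /(lt_swap lin) /(lt_supp lin).
have degG s x : #|section (G s) x| <= D by apply: grow_pairs_deg lin _.
exists F; split.
- apply: leq_trans (leq_imset_card _ _) _.
  by rewrite card_prod !card_tuple card_option mul2n -addnn expnD.
- move=> _ /imsetP[[u1 u2] _ ->] /=; rewrite /cont.
  case: ltnP => few.
    have h1 := dense_core_graph lin link_le E_ge D0 DQ few.
    have := graph_core_small (pmap id u2) (symG _) (GA _) (degG _) D0 h1.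
    have sub : graph_core A (G (pmap id u1)) D (pmap id u2) \subset A.
      by apply/subsetP => x; rewrite !in_set => /andP[/andP[]].
    rewrite cardsD (setIidPr sub) => h.
    have aux n c : c <= n -> n <= 48 * (n - c) -> 48 * c <= 47 * n by lia.
    exact: aux (subset_leq_card sub) h.
  have sub : dense_core A E Q D (pmap id u1) \subset A.
    by apply/subsetP => x; rewrite !in_set => /andP[].
  move: few; rewrite cardsD (setIidPr sub) => h.
  have aux n c : c <= n -> n <= 8 * (n - c) -> 48 * c <= 47 * n by lia.
  exact: aux (subset_leq_card sub) h.
- move=> I IA indep.
  have [|s1 [s1I sz1 st1]] := @greedy_fingerprint _ _ (new_pairs E D) Q 4 I _ Q0.
    move=> H v; rewrite disjoint_sym disjoint_subset; apply/subsetP => p.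
    by rewrite !in_set => /and3P[].
  have [|s2 [s2I sz2 st2]] := @greedy_fingerprint _ _ (new_nbrs (G s1)) D 24 I _ D0.
    move=> H v; rewrite disjoint_sym disjoint_subset; apply/subsetP => p.
    by rewrite !in_set => /andP[].
  (* A pair of the graph lies in the link of a vertex of [I], so no pair lies inside [I]. Hence the
     neighbours removed by the second stage are not in [I]. *)
  have Gind x y : (x, y) \in G s1 -> x \in I -> y \in I -> False.
    case/grow_pairs_sub => v /s1I vI vE xI yI.
    by move: (indep _ _ _ vI xI yI); rewrite vE.
  have GN : #|G s1| <= #|A| * D.
    rewrite -[#|G s1|]mul1n; apply: leq_card_section => [v p /GA//|v vS].
    by rewrite mul1n.
  have le1 : size s1 <= t.
    by rewrite -(leq_pmul2l Q0) (leq_trans sz1) // (leq_trans _ hs1) // -mulnA leq_mul2l GN orbT.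
  have WA : grow (new_nbrs (G s1)) s2 \subset A.
    apply/subsetP => x; elim: (s2) => [|u s IH] /=; first by rewrite inE.
    by rewrite !in_set => /orP[//|/andP[_ /symG /GA]].
  have le2 : size s2 <= t.
    rewrite -(leq_pmul2l D0) (leq_trans sz2) // (leq_trans _ hs2) //.
    by rewrite leq_mul2l subset_leq_card ?orbT.
  have [u1 e1] := bounded_seq_tuple le1; have [u2 e2] := bounded_seq_tuple le2.
  exists (cont s1 s2); first by apply/imsetP; exists (u1, u2); rewrite //= -e1 -e2.
  rewrite /cont; case: ltnP => _; apply/subsetP => x xI;
    rewrite !in_set (subsetP IA) //=; last first.
    by apply: st1.
  rewrite st2 // !andbT; apply/negP => xW.
  suff [u us ux] : exists2 u, u \in s2 & (u, x) \in G s1 by apply: Gind ux _ xI; apply: s2I.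
  move: xW; elim: (s2) => [|u s IH] /=; first by rewrite inE.
  rewrite !in_set => /orP[/IH[w ws wx]|/andP[_ ux]].
    by exists w; rewrite // inE ws orbT.
  by exists u; rewrite // inE eqxx.
Qed.

(** * Packing lines by triples *)

Lemma leq_card_bigcup (I U : finType) (P : {pred I}) (F : I -> {set U}) :
  #|\bigcup_(i in P) F i| <= \sum_(i in P) #|F i|.
Proof.
elim/big_ind2: _ => [|X a Y b hX hY|//]; first by rewrite cards0.
by apply: leq_trans (leq_card_setU _ _) _; apply: leq_add.
Qed.

(** Triples are removed while some class of [lid] has more than two points. At most two points per
    class remain, and each removed set of three points gives six ordered triples. *)
Lemma triple_packing (T L : finType) (lid : T -> L) (A : {set T}) :
  exists E : {set T * (T * T)}, [/\
    forall x y z, (x, (y, z)) \in E ->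
      [/\ x \in A, [&& x != y, y != z & x != z], lid x = lid y & lid y = lid z],
    forall x y z, (x, (y, z)) \in E -> (y, (x, z)) \in E /\ (x, (z, y)) \in E,
    forall x y z y' z', (x, (y, z)) \in E -> (x, (y', z')) \in E ->
      (y', z') = (y, z) \/ (y', z') = (z, y) &
    2 * #|A| <= #|E| + 4 * #|lid @: A|].
Proof.
have [n] := ubnP #|A|; elim: n A => // n IH A hA.
case: (leqP #|A| (2 * #|lid @: A|)) => hl.
  by exists set0; split=> [x y z|x y z|x y z y' z'|]; rewrite ?inE // cards0; lia.
have [l hf] : exists l, 2 < #|[set x in A | lid x == l]|.
  apply/existsP; apply: contraLR hl; rewrite negb_exists => /forallP small.
  rewrite -leqNgt -sum1_card (partition_big_imset lid) /= mulnC -sum_nat_const.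
  apply: leq_sum => l _; rewrite sum1_card leqNgt.
  by have := small l; rewrite cardsE; congr (~~ (2 < _)); apply: eq_card => x; rewrite !inE.
case/card_gt2P: hf => a [b [c [[]]]]; rewrite !inE.
move=> /andP[aA /eqP al] /andP[bA /eqP bl] /andP[cA /eqP cl] [ab bc ca].
pose X := [set a; b; c].
have cX : #|X| = 3 by rewrite /X -setUA !cardsU1 cards1 !inE negb_or ab bc eq_sym ca.
have sX : X \subset A by apply/subsetP => x; rewrite !inE -orbA => /or3P[] /eqP->.
have cA' : #|A :\: X| = #|A| - 3 by rewrite cardsD (setIidPr sX) cX.
have A3 : 3 <= #|A| by rewrite -cX subset_leq_card.
have [|E [E1 E2 E3 E4]] := IH (A :\: X); first by lia.
pose s := [:: (a, (b, c)); (a, (c, b)); (b, (a, c)); (b, (c, a)); (c, (a, b)); (c, (b, a))].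
have us : uniq s.
  move: ab bc ca; rewrite /s /= !inE !xpair_eqE.
  rewrite (eq_sym b a) (eq_sym c b) (eq_sym a c).
  by do 3 (move=> /negbTE->); rewrite ?andbF.
pose S := [set e in s].
have cS : #|S| = 6 by rewrite cardsE; move/card_uniqP: us.
have sS e : e \in S -> e.1 \in X.
  by rewrite !inE -!orbA; do 5 (case/orP; first by move/eqP->; rewrite /= eqxx ?orbT);
     move/eqP->; rewrite /= eqxx ?orbT.
have sE x y z : (x, (y, z)) \in E -> x \notin X.
  by case/E1; rewrite inE => /andP[].
have dis : [disjoint E & S].
  rewrite disjoint_subset; apply/subsetP => -[x [y z]] h; apply/negP => /sS /=.
  by apply/negP; apply: sE h.
have inS x y z : (x, (y, z)) \in S ->
   (x = a /\ y = b /\ z = c) \/ (x = a /\ y = c /\ z = b) \/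
   (x = b /\ y = a /\ z = c) \/ (x = b /\ y = c /\ z = a) \/
   (x = c /\ y = a /\ z = b) \/ (x = c /\ y = b /\ z = a).
  rewrite !inE; do 5 (case/orP; first by case/eqP=> -> -> ->; intuition).
  by case/eqP=> -> -> ->; intuition.
exists (E :|: S); split.
- move=> x y z; rewrite in_setU => /orP[/E1[]|].
    by rewrite inE => /andP[].
  by case/inS => [[-> [-> ->]]|[[-> [-> ->]]|[[-> [-> ->]]|
                  [[-> [-> ->]]|[[-> [-> ->]]|[-> [-> ->]]]]]]];
     rewrite ?ab ?bc ?ca ?[b == a]eq_sym ?[c == b]eq_sym ?[a == c]eq_sym ?ab ?bc ?ca
             ?al ?bl ?cl.
- move=> x y z; rewrite !in_setU => /orP[/E2[-> ->] //|].
  by case/inS => [[-> [-> ->]]|[[-> [-> ->]]|[[-> [-> ->]]|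
                  [[-> [-> ->]]|[[-> [-> ->]]|[-> [-> ->]]]]]]];
     rewrite !inE !eqxx ?orbT.
- move=> x y z y' z'; rewrite !in_setU => /orP[h|h] /orP[h'|h'].
  + exact: E3 h h'.
  + by move/sS: h' => /= h'; move: (sE _ _ _ h); rewrite h'.
  + by move/sS: h => /= h; move: (sE _ _ _ h'); rewrite h.
  + move: ab bc ca => /eqP ab /eqP bc /eqP ca.
    have {h} := inS _ _ _ h; have {h'} := inS _ _ _ h'.
    by intuition (subst; first [by left | by right | congruence]).
- rewrite cardsU disjoint_setI0 // cards0 subn0 cS.
  have : #|lid @: (A :\: X)| <= #|lid @: A|.
    by apply: subset_leq_card; apply: imsetS; apply: subsetDl.
  by clear - E4 cA' A3; lia.
Qed.

(** Packings of different directions share no pair, as two points lie on a common line in only one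
    direction. A point gets at most two ordered pairs per direction, and at most [2 * lam] points,
    so half of [A], stay unpacked. *)
Lemma direction_triples (T W L : finType) (lid : W -> T -> L) (V : {set W})
    (A : {set T}) (lam : nat) :
  (forall v w x y, v \in V -> w \in V -> x != y ->
     lid v x = lid v y -> lid w x = lid w y -> v = w) ->
  (forall v, v \in V -> #|lid v @: A| <= lam) -> 4 * lam <= #|A| ->
  exists E : {set T * (T * T)}, [/\ linear_triples A E,
    forall x, #|section E x| <= 2 * #|V|, #|V| * #|A| <= #|E| &
    forall x y z, (x, (y, z)) \in E -> exists2 v, v \in V &
      [/\ [&& x != y, y != z & x != z], lid v x = lid v y & lid v y = lid v z]].
Proof.
move=> dir lines big.
have [E hE] := fin_all_exists (fun v => triple_packing (lid v) A).
pose F := \bigcup_(v in V) E v.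
have FP x y z : (x, (y, z)) \in F -> exists2 v, v \in V & (x, (y, z)) \in E v.
  by case/bigcupP => v; exists v.
exists F; split.
- split.
  + by move=> v x y /FP[w wV]; have [h _ _ _] := hE w; case/h.
  + move=> v x y /FP[w wV]; have [_ h _ _] := hE w; case/h => h1 _.
    by apply/bigcupP; exists w.
  + move=> v x y /FP[w wV]; have [_ h _ _] := hE w; case/h => _ h1.
    by apply/bigcupP; exists w.
  + move=> x x' [y z] /FP[v vV h] /FP[w wV h'].
    have [v1 v2 v3 _] := hE v; have [w1 w2 _ _] := hE w.
    have [_ /and3P[_ yz _] _ lv] := v1 _ _ _ h.
    have [_ _ _ lw] := w1 _ _ _ h'.
    have e := dir _ _ _ _ vV wV yz lv lw; rewrite -e in h'.
    (* Rotating both triples to start at [y] compares two pairs attached to [y]: they agree up to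
       order, and the swapped order would force [z = x]. *)
    have r1 : (y, (z, x)) \in E v by apply: (proj2 (v2 _ _ _ _)); apply: (proj1 (v2 _ _ _ _)).
    have r2 : (y, (z, x')) \in E v by apply: (proj2 (v2 _ _ _ _)); apply: (proj1 (v2 _ _ _ _)).
    case: (v3 _ _ _ _ _ r1 r2) => [[->//]|[e1 _]].
    by have [_ /and3P[_ /eqP ne _] _ _] := v1 _ _ _ r1; case: ne.
- move=> x; rewrite mulnC -sum_nat_const.
  apply: (@leq_trans (\sum_(v in V) #|section (E v) x|)); last first.
    apply: leq_sum => v vV; have [_ _ h3 _] := hE v.
    case: (set_0Vmem (section (E v) x)) => [->|[[y z]]]; first by rewrite cards0.
    rewrite in_set => yz.
    apply: (@leq_trans #|[set (y, z); (z, y)]|); last by rewrite cards2; case: eqP.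
    apply: subset_leq_card; apply/subsetP => -[y' z']; rewrite in_set in_set2 => h.
    by case: (h3 _ _ _ _ _ yz h) => ->; rewrite ?eqxx ?orbT.
  apply: leq_trans (leq_card_bigcup _ _); apply: subset_leq_card.
  apply/subsetP => -[y z]; rewrite in_set => /FP[v vV h].
  by apply/bigcupP; exists v; rewrite // in_set.
- pose B := [set ve : W * (T * (T * T)) | (ve.1 \in V) && (ve.2 \in E ve.1)].
  have injB : {in B &, injective snd}.
    move=> [v [x [y z]]] [w [x' [y' z']]]; rewrite !in_set /= => /andP[vV h] /andP[wV h'] e.
    rewrite -e in h' *.
    have [v1 _ _ _] := hE v; have [w1 _ _ _] := hE w.
    have [_ /and3P[_ yz _] _ lv] := v1 _ _ _ h.
    have [_ _ _ lw] := w1 _ _ _ h'.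
    by rewrite (dir _ _ _ _ vV wV yz lv lw).
  apply: (@leq_trans #|B|); last first.
    rewrite -(card_in_imset injB); apply: subset_leq_card.
    apply/subsetP => _ /imsetP[[v e] + ->]; rewrite in_set /= => /andP[vV h].
    by apply/bigcupP; exists v.
  rewrite card_section (bigID (mem V)) /= -sum_nat_const.
  apply: leq_trans (leq_addr _ _); apply: leq_sum => v vV.
  have -> : section B v = E v by apply/setP => e; rewrite !in_set /= vV.
  have [_ _ _ h4] := hE v.
  have aux a e l : 2 * a <= e + 4 * l -> l <= lam -> 4 * lam <= a -> a <= e by lia.
  exact: aux h4 (lines _ vV) big.
- move=> x y z /FP[v vV h]; exists v => //.
  by have [v1 _ _ _] := hE v; have [_ ? ? ?] := v1 _ _ _ h.
Qed.

(** * Lines of the grid *)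

Definition grid (n : nat) : finType := ('I_n * 'I_n * 'I_n)%type.

(** For [v] with positive coordinates, the number of steps by [-v] that can be made from [x] inside
    the grid. *)
Definition height (n : nat) (v x : grid n) : nat :=
  minn (minn (x.1.1 %/ v.1.1) (x.1.2 %/ v.1.2)) (x.2 %/ v.2).

Definition ord_sub (n : nat) (x : 'I_n) (d : nat) : 'I_n :=
  Ordinal (leq_ltn_trans (leq_subr d x) (ltn_ord x)).

(* the lowest grid point of the line through [x] in direction [v] *)
Definition base (n : nat) (v x : grid n) : grid n :=
  (ord_sub x.1.1 (height v x * v.1.1), ord_sub x.1.2 (height v x * v.1.2),
   ord_sub x.2 (height v x * v.2)).

Definition on_ray (n : nat) (b v : grid n) (i : nat) (x : grid n) : Prop :=
  [/\ x.1.1 = b.1.1 + i * v.1.1 :> nat, x.1.2 = b.1.2 + i * v.1.2 :> nat &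
      x.2 = b.2 + i * v.2 :> nat].

Definition primitive (n : nat) (v : grid n) : bool :=
  [&& 0 < v.1.1, 0 < v.1.2, 0 < v.2 & gcdn (gcdn v.1.1 v.1.2) v.2 == 1].

Lemma grid_eq (n : nat) (x y : grid n) :
  x.1.1 = y.1.1 :> nat -> x.1.2 = y.1.2 :> nat -> x.2 = y.2 :> nat -> x = y.
Proof.
by case: x y => [[x1 x2] x3] [[y1 y2] y3] /= /val_inj-> /val_inj-> /val_inj->.
Qed.

Lemma on_ray_base (n : nat) (v x : grid n) : on_ray (base v x) v (height v x) x.
Proof.
split; rewrite /= subnK // /height.
- apply: leq_trans (leq_divM x.1.1 v.1.1).
  by rewrite leq_mul2r; apply/orP; right; lia.
- apply: leq_trans (leq_divM x.1.2 v.1.2).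
  by rewrite leq_mul2r; apply/orP; right; lia.
- apply: leq_trans (leq_divM x.2 v.2).
  by rewrite leq_mul2r; apply/orP; right; lia.
Qed.

Lemma on_ray_base_eq (n : nat) (b v x : grid n) (i : nat) :
  primitive v -> on_ray b v i x -> base v x = base v b.
Proof.
move=> /and4P[v1 v2 v3 _] [e1 e2 e3].
have hE : height v x = i + height v b.
  by rewrite /height e1 e2 e3 ![_ + i * _]addnC !divnMDl // -!addn_minr.
by apply: grid_eq; rewrite /= hE ?e1 ?e2 ?e3 mulnDl addnC subnDl.
Qed.

(** The displacement between [x] and [y] is both [i * v] and [j * w]; since [v] and [w] are
    primitive, the gcd of its coordinates is [i] as well as [j]. *)
Lemma direction_unique (n : nat) (v w x y : grid n) :
  primitive v -> primitive w -> x != y ->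
  base v x = base v y -> base w x = base w y -> v = w.
Proof.
move=> pv pw.
have [v1 v2 v3 gv] := and4P pv; have [w1 w2 w3 gw] := and4P pw.
wlog le : x y / height v x <= height v y => [H xy ev ew|xy ev ew].
  case: (leqP (height v x) (height v y)) => [h|/ltnW h]; first exact: (H x y).
  by apply: (H y x) => //; rewrite eq_sym.
have [a1 a2 a3] := on_ray_base v x; have [b1 b2 b3] := on_ray_base v y.
have [c1 c2 c3] := on_ray_base w x; have [d1 d2 d3] := on_ray_base w y.
rewrite -ev in b1 b2 b3; rewrite -ew in d1 d2 d3.
have lt : height v x < height v y.
  rewrite ltn_neqAle le andbT; apply: contra xy => /eqP e.
  by apply/eqP/grid_eq; rewrite ?a1 ?a2 ?a3 ?b1 ?b2 ?b3 e.
pose i := height v y - height v x; pose j := height w y - height w x.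
have ltw : height w x < height w y by nia.
have E1 : i * v.1.1 = j * w.1.1 by rewrite /i /j !mulnBl; lia.
have E2 : i * v.1.2 = j * w.1.2 by rewrite /i /j !mulnBl; lia.
have E3 : i * v.2 = j * w.2 by rewrite /i /j !mulnBl; lia.
have ij : i = j.
  rewrite -[i]muln1 -[j]muln1 -{1}(eqP gv) -(eqP gw).
  by rewrite !muln_gcdr E1 E2 E3.
have i0 : 0 < i by rewrite /i subn_gt0.
rewrite -ij in E1 E2 E3.
by apply: grid_eq; apply/eqP; rewrite -(eqn_pmul2l i0); apply/eqP.
Qed.

Lemma leq_card_ord (n m : nat) (X : {set 'I_n}) (g : nat -> nat) :
  {in X &, forall i j : 'I_n, g i = g j -> i = j} -> (forall i, i \in X -> g i < m) ->
  #|X| <= m.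
Proof.
move=> inj lt; rewrite cardE -(size_map (fun i : 'I_n => g i)) -(size_iota 0 m).
apply: uniq_leq_size => [|x /mapP[i]].
  by rewrite map_inj_in_uniq ?enum_uniq // => i j; rewrite !mem_enum; apply: inj.
by rewrite mem_enum mem_iota => /lt h ->.
Qed.

Definition small_directions (n k : nat) : {set grid n} :=
  [set v | [&& primitive v, v.1.1 <= k, v.1.2 <= k & v.2 <= k]].

(** Lines are counted by their lowest points. There the coordinate that attains the [height] has
    become a remainder below [k], so the point lies in one of three slabs of at most [k * n ^ 2]
    points. *)
Lemma card_lines (n k : nat) (A : {set grid n}) (v : grid n) :
  v \in small_directions n k -> #|base v @: A| <= 3 * (k * n ^ 2).
Proof.
rewrite in_set => /and4P[/and4P[v1 v2 v3 _] k1 k2 k3].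
pose X := [set i : 'I_n | i < k].
have cX : #|X| <= k.
  by apply: (@leq_card_ord _ _ _ id) => [i j _ _ /val_inj|i]; rewrite ?in_set.
pose B1 := setX (setX X [set: 'I_n]) [set: 'I_n].
pose B2 := setX (setX [set: 'I_n] X) [set: 'I_n].
pose B3 := setX (setX [set: 'I_n] [set: 'I_n]) X.
apply: (@leq_trans #|B1 :|: B2 :|: B3|); last first.
  apply: leq_trans (leq_card_setU _ _) _.
  apply: (@leq_trans (#|B1| + #|B2| + #|B3|)); first by rewrite leq_add2r leq_card_setU.
  by rewrite !cardsX cardsT card_ord expnS expn1; nia.
apply: subset_leq_card; apply/subsetP => _ /imsetP[x _ ->].
rewrite !in_setU !in_setX !in_setT /= !in_set /= !andbT /=.
have H (a b : nat) : 0 < b -> b <= k -> a - a %/ b * b < k.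
  by move=> b0 bk; rewrite {1}(divn_eq a b) addKn; apply: leq_trans bk; rewrite ltn_mod.
have h1 := H x.1.1 _ v1 k1; have h2 := H x.1.2 _ v2 k2; have h3 := H x.2 _ v3 k3.
move: h1 h2 h3; rewrite /height.
set a := x.1.1 %/ _; set b := x.1.2 %/ _; set c := x.2 %/ _ => h1 h2 h3.
case: (leqP (minn a b) c) => _; last by rewrite h3 ?orbT.
by case: (leqP a b) => _; rewrite ?h1 ?h2 ?orbT.
Qed.

(** Telescoping: [1 / d ^ 3] is at most [(1 / (d - 1) - 1 / d) / 2]. *)
Lemma sum_cubes_bound (k m : nat) :
  2 * m.+1 * (\sum_(2 <= d < m.+2) (k %/ d) ^ 3) <= k ^ 3 * m.
Proof.
elim: m => [|m IH]; first by rewrite big_geq.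
rewrite big_nat_recr //=; set S := \sum_(_ <= _ < _) _ in IH *.
set y := k %/ m.+2; have hy : (y * m.+2) ^ 3 <= k ^ 3 by rewrite leq_exp2r ?leq_divM.
rewrite -(leq_pmul2l (ltn0Sn m)).
have h1 : m.+2 * (2 * m.+1 * S) <= m.+2 * (k ^ 3 * m) by rewrite leq_mul2l IH orbT.
have h2 : 2 * m.+1 * m.+2 * y ^ 3 <= k ^ 3.
  apply: leq_trans hy; rewrite expnMn mulnC leq_mul2l; apply/orP; right.
  by rewrite !expnS expn0; nia.
by nia.
Qed.

(** Among the [k ^ 3] positive triples up to [k], those with a common divisor [d >= 2] number at
    most the sum of the [(k / d) ^ 3], which is at most half of [k ^ 3]. *)
Lemma card_small_directions (n k : nat) : k < n -> k ^ 3 <= 2 * #|small_directions n k|.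
Proof.
move=> kn; pose X d := [set i : 'I_n | [&& 0 < i, i <= k & d %| i]].
have X1 : k <= #|X 1|.
  rewrite cardE -(size_map val) -{1}(size_iota 1 k).
  apply: uniq_leq_size (iota_uniq _ _) _ => j; rewrite mem_iota => hj.
  have jn : j < n by lia.
  by apply/mapP; exists (Ordinal jn); rewrite // mem_enum in_set dvd1n /=; lia.
have Xd d : 1 < d -> #|X d| <= k %/ d.
  move=> d1; have d0 : 0 < d by lia.
  apply: (@leq_card_ord _ _ _ (fun i => (i %/ d).-1)) => [i j|i].
    rewrite !in_set => /and3P[i0 _ /dvdnP[a ea]] /and3P[j0 _ /dvdnP[b eb]].
    move=> e; apply: val_inj; move: i0 j0 e.
    rewrite /= ea eb !mulnK // !muln_gt0 => /andP[a0 _] /andP[b0 _] e.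
    by have -> : a = b by lia.
  rewrite in_set => /and3P[+ + /dvdnP[a ea]].
  by rewrite ea mulnK // muln_gt0 -leq_divRL // => /andP[a0 _] ?; lia.
pose B d := setX (setX (X d) (X d)) (X d).
have cB d : #|B d| = #|X d| ^ 3 by rewrite !cardsX !expnS expn0 muln1 mulnA.
have cov : B 1 \subset small_directions n k :|: \bigcup_(d < k.+1 | 1 < d) B d.
  apply/subsetP => -[[a b] c]; rewrite in_setU !in_setX !in_set !dvd1n !andbT /primitive /=.
  move=> /andP[/andP[/andP[a0 ak] /andP[b0 bk]] /andP[c0 ck]].
  rewrite a0 b0 c0 ak bk ck /= !andbT.
  set g := gcdn _ _; have g0 : 0 < g by rewrite gcdn_gt0 c0 orbT.
  case: eqP => //= g1; apply/bigcupP.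
  have gc : g %| c by apply: dvdn_gcdr.
  have gab : g %| gcdn a b by apply: dvdn_gcdl.
  have gk : g < k.+1 by rewrite ltnS (leq_trans _ ck) // dvdn_leq.
  exists (Ordinal gk) => /=; first by lia.
  rewrite !in_setX !in_set /= a0 ak b0 bk c0 ck gc.
  by rewrite (dvdn_trans gab (dvdn_gcdl _ _)) (dvdn_trans gab (dvdn_gcdr _ _)).
have h1 : k ^ 3 <= #|small_directions n k| + \sum_(d < k.+1 | 1 < d) (k %/ d) ^ 3.
  apply: (@leq_trans #|B 1|); first by rewrite cB leq_exp2r.
  apply: leq_trans (subset_leq_card cov) _.
  apply: leq_trans (leq_card_setU _ _) _; rewrite leq_add2l.
  apply: leq_trans (leq_card_bigcup _ _) _; apply: leq_sum => d d1.
  by rewrite cB leq_exp2r // Xd.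
case: k kn {X1 Xd cB cov X B} h1 => [//|k] kn h1.
have e : \sum_(d < k.+2 | 1 < d) (k.+1 %/ d) ^ 3 = \sum_(2 <= d < k.+2) (k.+1 %/ d) ^ 3.
  by rewrite [RHS]big_geq_mkord.
rewrite e in h1; have h2 := sum_cubes_bound k.+1 k.
move: h1 h2; set S := \sum_(_ <= _ < _) _; set P := k.+1 ^ 3 => h1 h2.
rewrite -(leq_pmul2l (ltn0Sn k)); nia.
Qed.

(** * Containers for line-free subsets of the grid *)

Definition line_free (n : nat) (I : {set grid n}) : Prop :=
  forall v x y z, primitive v -> x \in I -> y \in I -> z \in I ->
    [&& x != y, y != z & x != z] -> base v x = base v y -> base v y = base v z -> False.

Lemma card_grid (n : nat) : #|grid n| = n ^ 3.
Proof. by rewrite !card_prod card_ord !expnS expn0 muln1 mulnA. Qed.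

(* number of pairs of fingerprints of length at most [576 * q ^ 5] *)
Definition step_bound (q : nat) : nat := (q ^ 9).+1 ^ (2 * (576 * q ^ 5)).

Lemma grid_container_step (q : nat) (A : {set grid (q ^ 3)}) :
  0 < q -> 12 * q ^ 8 <= #|A| ->
  exists F : {set {set grid (q ^ 3)}}, [/\ #|F| <= step_bound q,
    forall C, C \in F -> 48 * #|C| <= 47 * #|A| &
    forall I : {set grid (q ^ 3)}, I \subset A -> line_free I ->
      exists2 C, C \in F & I \subset C].
Proof.
(* With this [k], a direction with coordinates up to [k] has at most [3 * k * q ^ 6 <= #|A| / 4]
   lines, as the packing requires. The lower bound on [#|A|] gives [k >= q ^ 2]. *)
move=> q0 big; pose k := #|A| %/ (12 * q ^ 6).
have q60 : 0 < q ^ 6 by rewrite expn_gt0 q0.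
have q50 : 0 < q ^ 5 by rewrite expn_gt0 q0.
have e8 : q ^ 8 = q ^ 6 * q ^ 2 by rewrite -expnD.
have e9 : q ^ 9 = q ^ 6 * q ^ 3 by rewrite -expnD.
have e6 : q ^ 6 = q ^ 5 * q by rewrite -expnSr.
have kq : q ^ 2 <= k by rewrite leq_divRL; nia.
have kA : 12 * q ^ 6 * k <= #|A| by rewrite mulnC leq_divM.
have q2 : q <= q ^ 2 by nia.
have k0 : 0 < k by lia.
have Ak : #|A| <= 24 * (q ^ 6 * k).
  have : #|A| < k.+1 * (12 * q ^ 6) by rewrite ltn_ceil; lia.
  by nia.
have kn : k < q ^ 3.
  have : #|A| <= q ^ 9 by rewrite (leq_trans (max_card _)) // card_grid -expnM.
  by rewrite e9; nia.
have kQ := card_small_directions kn; set V := small_directions _ k in kQ.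
have [E [lin link tot tri]] : exists E : {set grid (q ^ 3) * (grid (q ^ 3) * grid (q ^ 3))},
    [/\ linear_triples A E,
    forall x, #|section E x| <= 2 * #|V|, #|V| * #|A| <= #|E| &
    forall x y z, (x, (y, z)) \in E -> exists2 v, v \in V &
      [/\ [&& x != y, y != z & x != z], base v x = base v y & base v y = base v z]].
  apply: (@direction_triples _ _ _ (@base _) V A (3 * (k * (q ^ 3) ^ 2))).
  - move=> v w x y; rewrite !in_set => /and4P[pv _ _ _] /and4P[pw _ _ _].
    exact: direction_unique.
  - by move=> v; apply: card_lines.
  - by rewrite -expnM; lia.
have k3 : k ^ 3 = k * (k * k) by rewrite !expnS expn0 muln1.
(* Here [#|A|] has order [q ^ 6 * k] and [#|V|] is at least [k ^ 3 / 2]. The degree [D = q * k]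
   makes [576 * q ^ 5] long enough for the second fingerprint, and [k >= q ^ 2] makes it long enough
   for the first. *)
have [||||F [F1 F2 F3]] := @container_step _ A E #|V| (q * k) (576 * q ^ 5) lin link tot.
- by nia.
- by apply: leq_trans kQ; nia.
- have -> : 4 * #|A| * (q * k) = 4 * q * k * #|A| by nia.
  apply: (@leq_trans (4 * q * k * (24 * (q ^ 6 * k)))); first by rewrite leq_mul2l Ak orbT.
  have a1 : q ^ 5 * (k ^ 3) <= q ^ 5 * (2 * #|V|) by rewrite leq_mul2l kQ orbT.
  have a2 : q ^ 5 * k * k * q ^ 2 <= q ^ 5 * k * k * k by rewrite leq_mul2l kq orbT.
  have q2e : q ^ 2 = q * q by rewrite expnS expn1.
  move: a1 a2; rewrite e6 k3 q2e; move: #|V| (q ^ 5) => Q p; nia.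
- apply: (@leq_trans (24 * (24 * (q ^ 6 * k)))); first by rewrite leq_mul2l Ak orbT.
  by rewrite e6; move: (q ^ 5) => p; nia.
exists F; split => //; first by move: F1; rewrite card_grid -expnM.
move=> I IA free; apply: F3 => // v x y vI xI yI; apply/negP => /tri[w].
by rewrite in_set => /and4P[pw _ _ _] [d e1 e2]; apply: free e1 e2.
Qed.

(** Containers larger than [12 * q ^ 8] are replaced by containers of their own subsets; a round
    multiplies sizes by at most [47 / 48] and the count by at most [step_bound q]. *)
Lemma grid_containers_iter (q j : nat) (A : {set grid (q ^ 3)}) :
  0 < q -> 47 ^ j * #|A| <= 48 ^ j * (12 * q ^ 8) ->
  exists F : {set {set grid (q ^ 3)}}, [/\ #|F| <= step_bound q ^ j,
    forall C, C \in F -> #|C| <= 12 * q ^ 8 &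
    forall I : {set grid (q ^ 3)}, I \subset A -> line_free I ->
      exists2 C, C \in F & I \subset C].
Proof.
move=> q0; elim: j A => [|j IH] A hA.
  exists [set A]; split=> [|C|I IA _]; first by rewrite cards1.
    by rewrite inE => /eqP->; rewrite !expn0 !mul1n in hA.
  by exists A; rewrite ?inE.
have B0 : 0 < step_bound q by rewrite expn_gt0.
case: (leqP #|A| (12 * q ^ 8)) => small.
  exists [set A]; split=> [|C|I IA _]; first by rewrite cards1 expn_gt0 B0.
    by rewrite inE => /eqP->.
  by exists A; rewrite ?inE.
have [F [F1 F2 F3]] := grid_container_step q0 (ltnW small).
have /fin_all_exists[G hG] : forall C, exists G : {set {set grid (q ^ 3)}}, C \in F ->
    [/\ #|G| <= step_bound q ^ j,
    forall C, C \in G -> #|C| <= 12 * q ^ 8 &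
    forall I : {set grid (q ^ 3)}, I \subset C -> line_free I ->
      exists2 C, C \in G & I \subset C].
  move=> C; case: (boolP (C \in F)) => CF; last by exists set0.
  have [|G hG] := IH C; last by exists G.
  have h1 : 47 ^ j * (48 * #|C|) <= 47 ^ j * (47 * #|A|) by rewrite leq_mul2l F2 ?orbT.
  move: hA h1; rewrite (expnS 47) (expnS 48).
  by move: (47 ^ j) (48 ^ j) (12 * q ^ 8) #|A| #|C| => a b N x y; nia.
exists (\bigcup_(C in F) G C); split.
- apply: leq_trans (leq_card_bigcup _ _) _.
  apply: (@leq_trans (\sum_(C in F) step_bound q ^ j)).
    by apply: leq_sum => C /hG[].
  by rewrite sum_nat_const (expnS (step_bound q)) leq_mul2r F1 orbT.
- by move=> C /bigcupP[C' /hG[_ h _]]; apply: h.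
- move=> I IA free; have [C CF IC] := F3 _ IA free.
  have [_ _ h] := hG _ CF; have [C' C'G IC'] := h _ IC free.
  by exists C' => //; apply/bigcupP; exists C.
Qed.

Lemma bernoulli_nat (m j : nat) : m ^ j * (m + j) <= m * m.+1 ^ j.
Proof.
elim: j => [|j IH]; first by rewrite !expn0; lia.
rewrite !expnS; set a := m ^ j in IH *; set b := m.+1 ^ j in IH *.
by nia.
Qed.

(** Bernoulli's inequality gives [(1 + 1 / m) ^ m >= 2], which is raised to the power [l]. *)
Lemma doubling_pow (m l : nat) : 0 < m -> 2 ^ l * m ^ (m * l) <= m.+1 ^ (m * l).
Proof.
move=> m0; rewrite !(expnM _ m) -expnMn; case: l => [|l]; first by rewrite !expn0.
by rewrite leq_exp2r // -(leq_pmul2l m0) (leq_trans _ (bernoulli_nat m m)) //; nia.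
Qed.

Lemma grid_containers (q l : nat) :
  0 < q -> q <= 2 ^ l ->
  exists F : {set {set grid (q ^ 3)}}, [/\ #|F| <= step_bound q ^ (47 * l),
    forall C, C \in F -> #|C| <= 12 * q ^ 8 &
    forall I : {set grid (q ^ 3)}, line_free I -> exists2 C, C \in F & I \subset C].
Proof.
(* Over [47 * l] rounds the sizes shrink by [(48 / 47) ^ (47 * l) >= 2 ^ l >= q], which leads from
   [q ^ 9] down to order [q ^ 8]. *)
move=> q0 ql; have [|F [F1 F2 F3]] := @grid_containers_iter q (47 * l) setT q0.
  have e9 : (q ^ 3) ^ 3 = q * q ^ 8 by rewrite -expnM -expnS.
  have := @doubling_pow 47 l isT.
  rewrite cardsT card_grid e9; move: (q ^ 8) (47 ^ (47 * l)) (48 ^ (47 * l)) => p a b h.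
  have : q * a * p <= 2 ^ l * a * p by rewrite !leq_mul2r ql !orbT.
  have : 2 ^ l * a * p <= b * p by rewrite leq_mul2r h orbT.
  by move: (2 ^ l * a * p) => c; nia.
exists F; split => // I; apply: F3; exact: subsetT.
Qed.

(** * Random selection of points *)

Definition restrict (T J I : finType) (f : {ffun I -> T}) (g : {ffun J -> I}) : {ffun J -> T} :=
  [ffun i => f (g i)].

(** The values of a uniformly random [f] at distinct indices are independent and uniform. The map
    [phi] separates these values from the remaining ones. *)
Lemma card_restrict (T J I : finType) (g : {ffun J -> I}) (W : {set {ffun J -> T}}) :
  injective g ->
  #|[set f : {ffun I -> T} | restrict f g \in W]| * #|T| ^ #|J| <= #|W| * #|T| ^ #|I|.
Proof.
move=> inj; pose U : finType := {j : I | j \notin codom g}.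
pose phi (f : {ffun I -> T}) : {ffun J -> T} * {ffun U -> T} :=
  (restrict f g, [ffun j => f (val j)]).
have inj_phi : injective phi.
  move=> f f' [/ffunP e1 /ffunP e2]; apply/ffunP => i.
  case: (boolP (i \in codom g)) => [/codomP[j ->]|h].
    by have := e1 j; rewrite !ffunE.
  by have := e2 (Sub i h); rewrite !ffunE.
have cU : #|U| + #|J| = #|I|.
  by rewrite card_sig addnC -(card_codom inj) cardC.
rewrite -cU expnD mulnA leq_mul2r; apply/orP; right.
rewrite -card_ffun -[#|{: {ffun U -> T}}|]cardsT -cardsX -(card_imset _ inj_phi).
apply: subset_leq_card; apply/subsetP => _ /imsetP[f + ->].
by rewrite in_set in_setX in_setT andbT.
Qed.

Definition hits (T J I : finType) (W : {set {ffun J -> T}}) (f : {ffun I -> T}) :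
  {set {ffun J -> I}} := [set g : {ffun J -> I} | injectiveb g & restrict f g \in W].

(** Linearity of expectation over the index maps [g], with denominators cleared. *)
Lemma sum_card_hits (T J I : finType) (W : {set {ffun J -> T}}) :
  (\sum_(f : {ffun I -> T}) #|hits W f|) * #|T| ^ #|J| <=
  #|I| ^ #|J| * (#|W| * #|T| ^ #|I|).
Proof.
have -> : \sum_(f : {ffun I -> T}) #|hits W f| =
    \sum_(g : {ffun J -> I} | injectiveb g) #|[set f : {ffun I -> T} | restrict f g \in W]|.
  under eq_bigr => f _ do rewrite -sum1_card big_mkcond /=.
  rewrite exchange_big /= [RHS]big_mkcond /=; apply: eq_bigr => g _.
  rewrite -sum1_card; case: ifP => inj.
    by rewrite [RHS]big_mkcond; apply: eq_bigr => f _; rewrite !in_set inj.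
  by apply: big1 => f _; rewrite in_set inj.
rewrite big_distrl /=.
apply: (@leq_trans (\sum_(g : {ffun J -> I} | injectiveb g) (#|W| * #|T| ^ #|I|))).
  by apply: leq_sum => g /injectiveP inj; apply: (card_restrict W inj).
have <- : #|{: {ffun J -> I}}| = #|I| ^ #|J| by rewrite card_ffun.
by rewrite sum_nat_const leq_mul2r max_card orbT.
Qed.

Lemma card_maps_into (T I : finType) (S : {set I}) (C : {set T}) :
  #|[set f : {ffun I -> T} | f @: S \subset C]| * #|T| ^ #|S| = #|C| ^ #|S| * #|T| ^ #|I|.
Proof.
pose F (i : I) : {set T} := if i \in S then C else setT.
have -> : #|[set f : {ffun I -> T} | f @: S \subset C]| = #|family F|.
  apply: eq_card => f; rewrite in_set; apply/subsetP/familyP => h.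
    by move=> i; rewrite /F; case: ifP => iS; rewrite ?in_setT //; apply: h; apply: imset_f.
  by move=> _ /imsetP[i iS ->]; have := h i; rewrite /F iS.
rewrite card_family foldrE big_map big_enum /=.
rewrite (bigID (mem S)) /= (eq_bigr (fun=> #|C|)); last by move=> i iS; rewrite /F iS.
rewrite [X in _ * X * _](eq_bigr (fun=> #|T|)); last first.
  by move=> i /negbTE iS; rewrite /F iS cardsT.
rewrite !prod_nat_const -mulnA -expnD; congr (_ * _ ^ _).
by rewrite addnC -(cardC (mem S)).
Qed.

Definition captured (T I : finType) (m : nat) (F : {set {set T}}) (f : {ffun I -> T}) :
  {set {set I}} := [set S : {set I} | #|S| == m & [exists C in F, f @: S \subset C]].

(** Union bound over [m]-sets of indices and members of [F]: each pair succeeds with probability at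
    most [(n / #|T|) ^ m]. *)
Lemma sum_card_captured (T I : finType) (m n : nat) (F : {set {set T}}) :
  (forall C, C \in F -> #|C| <= n) ->
  (\sum_(f : {ffun I -> T}) #|captured m F f|) * #|T| ^ m <=
  'C(#|I|, m) * (#|F| * n ^ m) * #|T| ^ #|I|.
Proof.
move=> small; pose Z (S : {set I}) := [set f : {ffun I -> T} | [exists C in F, f @: S \subset C]].
have -> : \sum_(f : {ffun I -> T}) #|captured m F f| = \sum_(S : {set I} | #|S| == m) #|Z S|.
  under eq_bigr => f _ do rewrite -sum1_card big_mkcond /=.
  rewrite exchange_big /= [RHS]big_mkcond /=; apply: eq_bigr => S _.
  case: ifP => inj.
    by rewrite -[RHS]sum1_card [RHS]big_mkcond; apply: eq_bigr => f _; rewrite !in_set inj.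
  by apply: big1 => f _; rewrite in_set inj.
rewrite -mulnA -card_draws big_distrl /=.
rewrite (eq_bigl (fun S => S \in [set A : {set I} | #|A| == m])); last by move=> S; rewrite in_set.
rewrite -sum_nat_const; apply: leq_sum => S; rewrite in_set => /eqP Sm.
have cov : Z S \subset \bigcup_(C in F) [set f : {ffun I -> T} | f @: S \subset C].
  apply/subsetP => f; rewrite in_set => /existsP[C /andP[CF h]].
  by apply/bigcupP; exists C; rewrite // in_set.
apply: (@leq_trans ((\sum_(C in F) #|[set f : {ffun I -> T} | f @: S \subset C]|) * #|T| ^ m)).
  rewrite leq_mul2r; apply/orP; right.
  exact: leq_trans (subset_leq_card cov) (leq_card_bigcup _ _).
rewrite big_distrl /= -mulnA -sum_nat_const; apply: leq_sum => C CF.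
rewrite -{1}Sm card_maps_into Sm leq_mul2r; apply/orP; right.
by case: (m) => [|m']; rewrite ?expn0 // leq_exp2r // small.
Qed.

(** The deletion method: on average there are at most [K / 16] bad quadruples, [K / 16] coincidences
    and [1 / 4] captured sets. Some [f] captures nothing, and deleting one index per bad pattern
    leaves at least half of the indices. *)
Lemma random_selection (T : finType) (K m n : nat) (Bad : {set {ffun 'I_4 -> T}})
    (F : {set {set T}}) :
  0 < K -> 16 * K ^ 3 * #|Bad| <= #|T| ^ 4 -> 16 * K <= #|T| ->
  (forall C, C \in F -> #|C| <= n) ->
  4 * ('C(K, m) * (#|F| * n ^ m)) <= #|T| ^ m ->
  exists (f : {ffun 'I_K -> T}) (R : {set 'I_K}), [/\ K <= 2 * #|R|,
    {in R &, injective f},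
    forall g : {ffun 'I_4 -> 'I_K}, injective g -> (forall i, g i \in R) ->
      restrict f g \notin Bad &
    forall S : {set 'I_K}, #|S| = m -> forall C, C \in F -> ~~ (f @: S \subset C)].
Proof.
move=> K0 hBad hT small hF.
have T0 : 0 < #|T| by lia.
(* Points are drawn with repetition, so coincidences are handled as bad patterns on two indices. *)
pose Bad2 := [set h : {ffun bool -> T} | h false == h true].
have cBad2 : #|Bad2| <= #|T|.
  have inj : {in Bad2 &, injective (fun h : {ffun bool -> T} => h false)}.
    move=> h h'; rewrite !in_set => /eqP e /eqP e' eq; apply/ffunP => -[] //.
    by rewrite -e -e'.
  by rewrite -(card_in_imset inj) max_card.
pose M := #|T|; pose X (f : {ffun 'I_K -> T}) := #|hits Bad f|.
pose Y (f : {ffun 'I_K -> T}) := #|hits Bad2 f|.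
pose Z (f : {ffun 'I_K -> T}) := #|captured m F f|.
have sX : 16 * (\sum_f X f) <= K * M ^ K.
  have := @sum_card_hits T _ 'I_K Bad; rewrite -/M !card_ord => h.
  have M4 : 0 < M ^ 4 by rewrite expn_gt0 T0.
  rewrite -(leq_pmul2r M4) -mulnA.
  apply: leq_trans (leq_mul (leqnn 16) h) _.
  rewrite expnS; move: hBad; rewrite -/M.
  move: (K ^ 3) #|Bad| (M ^ 4) (M ^ K) => a b c d hBad.
  have : 16 * a * b * (K * d) <= c * (K * d) by rewrite leq_mul2r hBad orbT.
  by nia.
have sY : 16 * (\sum_f Y f) <= K * M ^ K.
  have := @sum_card_hits T _ 'I_K Bad2; rewrite -/M card_bool !card_ord => h.
  have M2 : 0 < M ^ 2 by rewrite expn_gt0 T0.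
  rewrite -(leq_pmul2r M2) -mulnA.
  apply: leq_trans (leq_mul (leqnn 16) h) _.
  move: cBad2 hT; rewrite -/M !(expnS _ 1) !expn1.
  move: #|Bad2| (M ^ K) => b d h1 h2.
  have : (16 * K) * b <= M * M by apply: leq_mul.
  by nia.
have sZ : 4 * (\sum_f Z f) <= M ^ K.
  have := @sum_card_captured T 'I_K m n F small; rewrite -/M card_ord => h.
  have Mm : 0 < M ^ m by rewrite expn_gt0 T0.
  rewrite -(leq_pmul2r Mm) -mulnA.
  apply: leq_trans (leq_mul (leqnn 4) h) _.
  by rewrite mulnA [leqRHS]mulnC leq_mul2r hF orbT.
(* The average of this weight is at most [3 * K]. A value below [4 * K] forces [Z f = 0] and
   [X f + Y f < K / 4]. *)
have [f hf] : exists f : {ffun 'I_K -> T}, 16 * X f + 16 * Y f + 4 * K * Z f < 4 * K.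
  apply/existsP; apply: contraT; rewrite negb_exists => /forallP all_ge.
  have : \sum_(f : {ffun 'I_K -> T}) 4 * K <=
      \sum_(f : {ffun 'I_K -> T}) (16 * X f + 16 * Y f + 4 * K * Z f).
    by apply: leq_sum => f _; have := all_ge f; rewrite -leqNgt.
  rewrite sum_nat_const card_ffun card_ord 2!big_split /= -!big_distrr /=.
  move: sX sY sZ; rewrite -/M.
  have : 0 < M ^ K by rewrite expn_gt0 T0.
  move: (M ^ K) (\sum_f X f) (\sum_f Y f) (\sum_f Z f) => a b c d a0 h1 h2 h3 h4.
  have h5 : K * (4 * d) <= K * a by rewrite leq_mul2l h3 orbT.
  have h6 : 0 < a * K by rewrite muln_gt0 a0.
  by exfalso; lia.
have Z0 : Z f = 0 by nia.
exists f, (~: ([set g ord0 | g : {ffun 'I_4 -> 'I_K} in hits Bad f] :|: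
               [set g false | g : {ffun bool -> 'I_K} in hits Bad2 f])).
split.
- rewrite cardsCs setCK card_ord.
  set B := _ :|: _; have : #|B| <= X f + Y f.
    apply: leq_trans (leq_card_setU _ _) _.
    by apply: leq_add; apply: leq_imset_card.
  by move: #|B| => b; lia.
- move=> i j; rewrite !in_setC !in_setU !negb_or => /andP[_ hi] _ e.
  apply/eqP; apply: contraNT hi => ij.
  pose g : {ffun bool -> 'I_K} := [ffun b => if b then j else i].
  apply/imsetP; exists g; last by rewrite ffunE.
  rewrite !in_set !ffunE e eqxx andbT; apply/injectiveP => -[] [] //; rewrite !ffunE => e'.
    by rewrite e' eqxx in ij.
  by rewrite e' eqxx in ij.
- move=> g inj gR; apply/negP => h.
  have := gR ord0; rewrite in_setC in_setU negb_or => /andP[/negP[]].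
  by apply/imsetP; exists g => //; rewrite in_set h andbT; apply/injectiveP.
- move=> S Sm C CF; apply/negP => h.
  have : S \in captured m F f.
    by rewrite in_set Sm eqxx /=; apply/existsP; exists C; rewrite CF.
  by rewrite (cards0_eq Z0) in_set0.
Qed.

(** * Counting collinear quadruples *)

Lemma harmonic_bound (N l : nat) : \sum_(1 <= c < 2 ^ l) N %/ c <= N * l.
Proof.
elim: l => [|l IH]; first by rewrite big_geq.
(* The dyadic block from [2 ^ l] to [2 ^ (l + 1)] contributes at most [N]. *)
rewrite (big_cat_nat (n := 2 ^ l)) /= ?expn_gt0 ?leq_exp2l // mulnS addnC.
apply: leq_add => //.
apply: (@leq_trans (\sum_(2 ^ l <= c < 2 ^ l.+1) N %/ 2 ^ l)).
  rewrite big_nat [leqRHS]big_nat; apply: leq_sum => c /andP[h _].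
  by apply: leq_div2l; rewrite ?expn_gt0.
rewrite sum_nat_const_nat expnS mul2n -addnn addnK mulnC; exact: leq_divM.
Qed.

(** Listing by increasing height makes four points of a line appear once and not in all 24
    orders. *)
Definition four_on_line (n : nat) : {set {ffun 'I_4 -> grid n}} :=
  [set w : {ffun 'I_4 -> grid n} | [exists v, [&& primitive v,
     [forall i, base v (w i) == base v (w ord0)] &
     [forall i : 'I_4, forall j : 'I_4, (i < j) ==> (height v (w i) < height v (w j))]]]].

Definition ord_add (n : nat) (x : 'I_n) (d : nat) : 'I_n :=
  Ordinal (ltn_pmod (x + d) (leq_ltn_trans (leq0n x) (ltn_ord x))).

Definition ray_point (n : nat) (b v : grid n) (i : nat) : grid n :=
  (ord_add b.1.1 (i * v.1.1), ord_add b.1.2 (i * v.1.2), ord_add b.2 (i * v.2)).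

Lemma ray_pointE (n : nat) (b v x : grid n) (i : nat) :
  on_ray b v i x -> x = ray_point b v i.
Proof.
by case=> e1 e2 e3; apply: grid_eq; rewrite /= -?e1 -?e2 -?e3 modn_small.
Qed.

Lemma on_ray_diff (n : nat) (v x y : grid n) :
  base v x = base v y -> height v x <= height v y ->
  on_ray x v (height v y - height v x) y.
Proof.
move=> e le; have [a1 a2 a3] := on_ray_base v x; have [b1 b2 b3] := on_ray_base v y.
rewrite -e in b1 b2 b3.
by split; rewrite mulnBl; [rewrite {1}b1 {1}a1 | rewrite {1}b2 {1}a2 | rewrite {1}b3 {1}a3];
   rewrite -addnA subnKC // leq_mul2r le orbT.
Qed.

(** A quadruple is given by its lowest point, its direction and the step counts of the other points.
    If the last count is [c], there are at most [(n / c) ^ 3] directions and [c ^ 2] middle counts,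
    so the total is [n ^ 5] times a harmonic sum. *)
Lemma card_four_on_line (n l : nat) : n <= 2 ^ l -> #|four_on_line n| <= n ^ 6 * l.
Proof.
move=> nl; pose X (c : nat) := [set i : 'I_n | 0 < i & c * i < n].
pose Y (c : nat) := [set i : 'I_n | i < c].
have cX (c : nat) : 0 < c -> #|X c| <= n %/ c.
  move=> c0; apply: (@leq_card_ord _ _ _ predn) => [i j|i]; rewrite !in_set.
    by move=> /andP[i0 _] /andP[j0 _] e; apply: val_inj => /=; lia.
  by move=> /andP[i0 /ltnW h]; rewrite prednK // leq_divRL // mulnC.
have cY c : #|Y c| <= c.
  by apply: (@leq_card_ord _ _ _ id) => [i j _ _ /val_inj|i]; rewrite ?in_set.
pose par : finType := (grid n * (grid n * ('I_n * 'I_n)))%type.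
pose phi (c : nat) (p : par) : {ffun 'I_4 -> grid n} :=
  [ffun i : 'I_4 => ray_point p.1 p.2.1
    (nth 0 [:: 0; nat_of_ord p.2.2.1; nat_of_ord p.2.2.2; c] i)].
pose D (c : nat) : {set par} :=
  setX setT (setX (setX (setX (X c) (X c)) (X c)) (setX (Y c) (Y c))).
have cov : four_on_line n \subset \bigcup_(c < n | 0 < c) phi c @: D c.
  apply/subsetP => w; rewrite in_set => /existsP[v /and3P[pv /forallP hb /forallP hh]].
  have hb' i : base v (w ord0) = base v (w i) by rewrite (eqP (hb i)).
  have hh' (i j : 'I_4) : i < j -> height v (w i) < height v (w j).
    by move=> ij; have /forallP/(_ j) := hh i; rewrite ij.
  pose o (i : nat) (h : i < 4) : 'I_4 := Ordinal h.
  pose d (i : 'I_4) := height v (w i) - height v (w ord0).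
  have ray i : on_ray (w ord0) v (d i) (w i).
    apply: on_ray_diff => //; case: (posnP i) => [i0|i0]; last by apply: ltnW; apply: hh'.
    by rewrite (_ : i = ord0) //; apply: val_inj.
  pose c := d ord_max.
  have h1 : height v (w ord0) < height v (w (o 1 isT)) by apply: hh'.
  have h2 : height v (w (o 1 isT)) < height v (w (o 2 isT)) by apply: hh'.
  have h3 : height v (w (o 2 isT)) < height v (w ord_max) by apply: hh'.
  have [r1 r2 r3] := ray ord_max; rewrite -/c in r1 r2 r3.
  have [v1 v2 v3 _] := and4P pv.
  have c0 : 0 < c by rewrite /c /d; lia.
  have m1 : c * v.1.1 < n by apply: leq_ltn_trans (ltn_ord (w ord_max).1.1); rewrite r1 leq_addl.
  have m2 : c * v.1.2 < n by apply: leq_ltn_trans (ltn_ord (w ord_max).1.2); rewrite r2 leq_addl.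
  have m3 : c * v.2 < n by apply: leq_ltn_trans (ltn_ord (w ord_max).2); rewrite r3 leq_addl.
  have cn : c < n by apply: leq_ltn_trans m1; rewrite leq_pmulr.
  have ac : d (o 1 isT) < c by rewrite /c /d; lia.
  have bc : d (o 2 isT) < c by rewrite /c /d; lia.
  apply/bigcupP; exists (Ordinal cn) => //=; apply/imsetP.
  exists (w ord0, (v, (Ordinal (ltn_trans ac cn), Ordinal (ltn_trans bc cn)))).
    by rewrite !in_setX !in_set /= ac bc v1 v2 v3 m1 m2 m3.
  apply/ffunP => i; rewrite ffunE /= {1}(ray_pointE (ray i)); congr (ray_point _ _ _).
  case: i => -[|[|[|[|//]]]] hi /=.
  - by rewrite /d (_ : Ordinal hi = ord0) ?subnn //; apply: val_inj.
  - by congr (d _); apply: val_inj.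
  - by congr (d _); apply: val_inj.
  - by rewrite /c; congr (d _); apply: val_inj.
apply: leq_trans (subset_leq_card cov) _.
apply: leq_trans (leq_card_bigcup _ _) _.
apply: (@leq_trans (\sum_(c < n | 0 < c) n ^ 5 * (n %/ c))).
  apply: leq_sum => c c0; apply: leq_trans (leq_imset_card _ _) _.
  rewrite !cardsX cardsT card_grid.
  have := cX c c0; have := cY c; have := leq_divM n c.
  move: #|X c| #|Y c| (n %/ c) => x y z h hy hx.
  have e1 : x * x * x <= z * z * z by rewrite !leq_mul.
  have e2 : y * y <= c * c by rewrite leq_mul.
  have e3 : (z * c) * (z * c) <= n * n by rewrite leq_mul.
  have e4 : x * x * x * (y * y) <= z * z * z * (c * c) by rewrite leq_mul.
  have -> : n ^ 5 = n ^ 3 * (n * n) by rewrite mulnn -expnD.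
  apply: (@leq_trans (n ^ 3 * (z * z * z * (c * c)))); first by rewrite leq_mul2l e4 orbT.
  have : n ^ 3 * z * ((z * c) * (z * c)) <= n ^ 3 * z * (n * n) by rewrite leq_mul2l e3 orbT.
  by move: (n ^ 3) => t; lia.
have -> : n ^ 6 = n ^ 5 * n by rewrite -expnSr.
rewrite -big_distrr /= -mulnA leq_mul2l; apply/orP; right.
apply: leq_trans (harmonic_bound n l).
rewrite -(big_geq_mkord 1 n xpredT (fun c => n %/ c)) /=.
case: (posnP n) => [->|n0]; first by rewrite big_geq.
by rewrite [leqRHS](big_cat_nat (n := n)) //= leq_addr.
Qed.

(** * Estimates for the union bound over containers *)

Lemma pow_fact_bound (m : nat) : m ^ m <= 3 ^ m * m`!.
Proof.
(* This is [(1 + 1 / n) ^ j <= 1 + j / n + (j / n) ^ 2]; at [j = n] the right side is the constant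
   [3] of the lemma. *)
have H n j : j <= n -> n ^ 2 * n.+1 ^ j <= n ^ j * (n ^ 2 + j * n + j ^ 2).
  elim: j => [|j IH] jn; first by rewrite !expn0; lia.
  have := IH (ltnW jn); rewrite !(expnS _ j) !(expnS _ 1) !expn1.
  move: (n.+1 ^ j) (n ^ j) => a b h.
  have h1 : n.+1 * (n * n * a) <= n.+1 * (b * (n * n + j * n + j * j)) by rewrite leq_mul2l h orbT.
  have h2 : n.+1 * (n * n + j * n + j * j) <= n * (n * n + j.+1 * n + j.+1 * j.+1) by nia.
  have h3 : b * (n.+1 * (n * n + j * n + j * j)) <= b * (n * (n * n + j.+1 * n + j.+1 * j.+1)).
    by rewrite leq_mul2l h2 orbT.
  by nia.
elim: m => // m IH; case: (posnP m) => [->//|m0].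
have h := H m m (leqnn m).
have h1 : m.+1 ^ m <= 3 * m ^ m.
  have m2 : 0 < m ^ 2 by rewrite expn_gt0 m0.
  rewrite -(leq_pmul2l m2); apply: leq_trans h _.
  by rewrite !(expnS _ 1) !expn1; move: (m ^ m) => a; nia.
rewrite factS !expnS; move: IH h1; move: (m ^ m) (m.+1 ^ m) (3 ^ m) m`! => a b c d IH h1.
have : m.+1 * b <= m.+1 * (3 * (c * d)).
  by rewrite leq_mul2l (leq_trans h1) ?orbT // leq_mul2l IH orbT.
by nia.
Qed.

(** ['C(K, m)] is at most [(3 * K / m) ^ m], and doubling the base absorbs the factor [4 * f]; hence
    the [6]. *)
Lemma binomial_count_bound (K m f n M : nat) :
  0 < m -> 4 * f <= 2 ^ m -> 6 * (K * n) <= m * M -> 4 * ('C(K, m) * (f * n ^ m)) <= M ^ m.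
Proof.
move=> m0 hf hK.
have mm : 0 < m ^ m by rewrite expn_gt0 m0.
rewrite -(leq_pmul2l mm).
have h1 : 'C(K, m) * m`! <= K ^ m.
  rewrite bin_ffact; elim: (m) => [|j IH]; first by rewrite ffactn0.
  by rewrite ffactnSr expnSr leq_mul // leq_subr.
have h2 : 'C(K, m) * m ^ m <= 3 ^ m * K ^ m.
  apply: leq_trans (leq_mul (leqnn _) (pow_fact_bound m)) _.
  by rewrite mulnCA leq_mul2l h1 orbT.
have h3 : 2 ^ m * (3 ^ m * K ^ m) * n ^ m <= m ^ m * M ^ m.
  by rewrite mulnA -!expnMn leq_exp2r //; move: hK; nia.
apply: leq_trans h3.
have h4 : (4 * f) * ('C(K, m) * m ^ m) <= 2 ^ m * (3 ^ m * K ^ m) by apply: leq_mul.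
have : (4 * f) * ('C(K, m) * m ^ m) * n ^ m <= 2 ^ m * (3 ^ m * K ^ m) * n ^ m.
  by rewrite leq_mul2r h4 orbT.
by apply: leq_trans; apply: eq_leq; move: (m ^ m) 'C(K, m) (n ^ m) => a b c; lia.
Qed.

Lemma step_bound_pow : exists A, forall q l, 0 < l -> q <= 2 ^ l ->
  step_bound q ^ (47 * l) <= 2 ^ (A * (l ^ 2 * q ^ 5)).
Proof.
exists (10 * (2 * 576 * 47)) => q l l0 ql.
have h : (q ^ 9).+1 <= 2 ^ (10 * l).
  have h1 : q ^ 9 <= (2 ^ l) ^ 9 by rewrite leq_exp2r.
  have h2 : 2 <= 2 ^ l by rewrite -{1}(expn1 2) leq_exp2l.
  have h3 : 0 < (2 ^ l) ^ 9 by rewrite !expn_gt0.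
  rewrite [10 * l]mulnC expnM (expnS (2 ^ l)); move: h1 h2 h3.
  by move: (q ^ 9) (2 ^ l) ((2 ^ l) ^ 9) => a b c; nia.
rewrite /step_bound -expnM.
apply: (@leq_trans ((2 ^ (10 * l)) ^ (2 * (576 * q ^ 5) * (47 * l)))).
  by case: (_ * (47 * l)) => [//|e]; rewrite leq_exp2r.
rewrite -expnM leq_exp2l //; apply: eq_leq.
by rewrite (expnS l 1) expn1; move: (q ^ 5) => p; lia.
Qed.

(** * Selecting grid points with exact collinear triples *)

Lemma subset_of_size (T : finType) (A : {set T}) (m : nat) :
  m <= #|A| -> exists2 B : {set T}, B \subset A & #|B| = m.
Proof.
move=> mA; exists [set x in take m (enum A)].
  by apply/subsetP => x; rewrite in_set => /mem_take; rewrite mem_enum.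
rewrite cardsE (card_uniqP _) ?take_uniq ?enum_uniq // size_take -cardE.
by case: ltngtP mA.
Qed.

(** Sorting by height gives the order that [four_on_line] demands; it is strict because points of
    one line with equal heights coincide. *)
Lemma four_points_hit (n K : nat) (f : {ffun 'I_K -> grid n}) (R : {set 'I_K})
    (v : grid n) (s : seq 'I_K) (b : grid n) :
  primitive v -> {in R &, injective f} -> size s = 4 -> uniq s -> {subset s <= R} ->
  (forall i, i \in s -> base v (f i) = b) ->
  exists g : {ffun 'I_4 -> 'I_K}, [/\ injective g, forall i, g i \in R &
    restrict f g \in four_on_line n].
Proof.
move=> pv inj s4 us sR hb.
pose le (i j : 'I_K) := height v (f i) <= height v (f j).
have le_total : total le by move=> i j; apply: leq_total.
have le_trans : transitive le by move=> i j k; apply: leq_trans.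
pose t := sort le s.
have tE : t =i s by apply: mem_sort.
have ut : uniq t by rewrite sort_uniq.
have t4 : size t = 4 by rewrite size_sort.
have st : sorted le t by apply: sort_sorted.
have [i0 _] : exists i, i \in t by case: (t) t4 => // a t' _; exists a; rewrite inE eqxx.
pose g : {ffun 'I_4 -> 'I_K} := [ffun i : 'I_4 => nth i0 t i].
have gs i : g i \in s by rewrite -tE ffunE mem_nth // t4.
have ginj : injective g.
  move=> i j /eqP; rewrite !ffunE nth_uniq ?t4 // => /eqP; exact: val_inj.
have fg i : restrict f g i = f (g i) by rewrite [LHS]ffunE.
exists g; split=> [//|i|]; first exact: sR.
rewrite in_set; apply/existsP; exists v; apply/and3P; split=> //.
  by apply/forallP => i; rewrite !fg !hb.
apply/forallP => i; apply/forallP => j; apply/implyP => ij.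
rewrite ltn_neqAle; apply/andP; split.
  apply/eqP; rewrite !fg => eh.
  have [a1 a2 a3] := on_ray_base v (f (g i)).
  have [b1 b2 b3] := on_ray_base v (f (g j)).
  have eb : base v (f (g i)) = base v (f (g j)) by rewrite !hb.
  have e : f (g i) = f (g j).
    by apply: grid_eq; [rewrite a1 b1 eb eh | rewrite a2 b2 eb eh | rewrite a3 b3 eb eh].
  have eg : i = j by apply: ginj; apply: inj e; apply: sR.
  by rewrite eg ltnn in ij.
have := sorted_leq_nth le_trans (fun i => leqnn _) i0 st.
by move=> /(_ i j); rewrite !inE t4 !ltn_ord !fg !ffunE => h; apply: h (ltnW ij).
Qed.

Theorem grid_selection : exists c, forall q l N, 0 < N -> 0 < l -> q <= 2 ^ l ->
  8 * l * N <= q ^ 6 ->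
  exists h : 'I_N -> grid (q ^ 3), injective h /\
  forall S : {set 'I_N}, c * (l ^ 2 * q ^ 5) <= #|S| ->
  exists v i j k, [/\ primitive v, [/\ i \in S, j \in S & k \in S],
    [&& i != j, j != k & i != k],
    base v (h i) = base v (h j) /\ base v (h j) = base v (h k) &
    forall t, base v (h t) = base v (h i) -> [|| t == i, t == j | t == k]].
Proof.
have [A hA] := step_bound_pow.
(* With [x = l ^ 2 * q ^ 5], the number of containers requires [A * x + 2 <= m]. Their size
   [12 * q ^ 8] and the [2 * N] draws require [144 * q ^ 5 <= m], where [144 = 6 * 2 * 12]. *)
exists (A + 146) => q l N N0 l0 ql hN.
have q0 : 0 < q by case: (posnP q) hN => // ->; rewrite exp0n //; nia.
have q60 : 8 <= q ^ 6 by nia.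
have q50 : 0 < q ^ 5 by rewrite expn_gt0 q0.
have [F [F1 F2 F3]] := grid_containers q0 ql.
pose m := (A + 146) * (l ^ 2 * q ^ 5).
have lq0 : 0 < l ^ 2 * q ^ 5 by rewrite muln_gt0 q50 expn_gt0 l0.
have m0 : 0 < m by rewrite muln_gt0 lq0 andbT; lia.
have cT : #|grid (q ^ 3)| = q ^ 9 by rewrite card_grid -expnM.
have e9 : q ^ 9 = q ^ 6 * q ^ 3 by rewrite -expnD.
have nl : q ^ 3 <= 2 ^ (3 * l) by rewrite [3 * l]mulnC expnM leq_exp2r.
have q3 : 4 <= q ^ 3.
  have q1 : 1 < q by case: q q0 q60 {ql hN q50 F F1 F2 F3 m lq0 m0 cT e9 nl} => [//|[]].
  by apply: (@leq_trans (2 ^ 3)); rewrite ?leq_exp2r.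
have [|||||f [R [R1 R2 R3 R4]]] := @random_selection (grid (q ^ 3)) (2 * N) m (12 * q ^ 8)
  (four_on_line (q ^ 3)) F.
- by lia.
- rewrite cT; apply: leq_trans (leq_mul (leqnn _) (card_four_on_line nl)) _.
  have h3 : (8 * l * N) ^ 3 <= (q ^ 6) ^ 3 by rewrite leq_exp2r.
  have -> : (q ^ 9) ^ 4 = (q ^ 6) ^ 3 * (q ^ 3) ^ 6 by rewrite -!expnM -expnD.
  move: h3; move: ((q ^ 6) ^ 3) ((q ^ 3) ^ 6) => a b h3.
  have h4 : 16 * (2 * N) ^ 3 * (3 * l) <= a.
    apply: leq_trans h3; rewrite !expnMn.
    have : l <= l ^ 3 by rewrite -{1}(expn1 l) leq_pexp2l.
    rewrite !(expnS 8) !(expnS 2) !expn0; move: (N ^ 3) (l ^ 3) => x y; nia.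
  have : 16 * (2 * N) ^ 3 * (3 * l) * b <= a * b by rewrite leq_mul2r h4 orbT.
  by move: ((2 * N) ^ 3) => x; lia.
- by rewrite cT e9; move: (q ^ 6) (q ^ 3) hN q3 => a b; nia.
- exact: F2.
- rewrite cT; apply: binomial_count_bound => //.
    apply: leq_trans (leq_mul (leqnn 4) (leq_trans F1 (hA _ _ l0 ql))) _.
    rewrite (_ : 4 = 2 ^ 2) // -expnD leq_exp2l // /m mulnDl.
    by move: (l ^ 2 * q ^ 5) lq0 => x; lia.
  have -> : q ^ 9 = q * q ^ 8 by rewrite -expnS.
  have h1 : N <= q ^ 6 by nia.
  have h2 : q ^ 6 = q ^ 5 * q by rewrite -expnSr.
  have h3 : 146 * q ^ 5 <= m.
    rewrite /m; apply: leq_mul; first by lia.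
    by rewrite leq_pmull // expn_gt0 l0.
  have h4 : 144 * N <= m * q by nia.
  have : 144 * N * q ^ 8 <= m * q * q ^ 8 by rewrite leq_mul2r h4 orbT.
  by move: (q ^ 8) => x; lia.
have NR : N <= #|R| by lia.
pose e (i : 'I_N) : 'I_(2 * N) := enum_val (widen_ord NR i).
have eR i : e i \in R by apply: enum_valP.
have einj : injective e by move=> i j /enum_val_inj /(congr1 val) /= /val_inj.
exists (fun i => f (e i)); split.
  by move=> i j /R2 h; apply: einj; apply: h.
move=> S; rewrite -/m => mS.
have [|B BS Bm] := @subset_of_size _ (e @: S) m; first by rewrite card_imset.
pose I := f @: B.
pose tri (p : grid (q ^ 3) * (grid (q ^ 3) * (grid (q ^ 3) * grid (q ^ 3)))) :=
  let: (v, (x, (y, z))) := p in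
  [&& primitive v, x \in I, y \in I, z \in I, [&& x != y, y != z & x != z],
      base v x == base v y & base v y == base v z].
(* Without a collinear triple [I] would be line-free and so lie in a container, which the selection
   excludes. *)
case: (boolP [exists p, tri p]) => [/existsP|no]; last first.
  have [|C CF IC] := F3 I.
    move=> v x y z pv xI yI zI d e1 e2; move/negP: no; apply; apply/existsP.
    by exists (v, (x, (y, z))); rewrite /tri pv xI yI zI d e1 e2 !eqxx.
  by move: (R4 _ Bm _ CF); rewrite IC.
case=> -[v [x [y z]]] /and5P[pv xI yI zI /and3P[d /eqP e1 /eqP e2]].
have pre u : u \in I -> exists2 i, i \in S & u = f (e i).
  by case/imsetP => b /(subsetP BS) /imsetP[i iS ->] ->; exists i.
have [i iS xi] := pre _ xI; have [j jS yj] := pre _ yI; have [k kS zk] := pre _ zI.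
subst x y z; exists v, i, j, k.
have d' : [&& i != j, j != k & i != k].
  by move: d; case/and3P => d1 d2 d3; apply/and3P; split;
     [apply: contra d1 | apply: contra d2 | apply: contra d3] => /eqP->.
(* A further selected point on this line would give a bad quadruple of surviving indices. *)
split=> // t ht; apply: contraT; rewrite !negb_or => /and3P[ti tj tk].
have [|||g [g1 g2 g3]] := @four_points_hit _ _ f R v [:: e t; e i; e j; e k]
  (base v (f (e i))) pv R2 erefl.
- rewrite /= !inE !negb_or !(inj_eq einj) ti tj tk.
  by case/and3P: d' => -> -> ->.
- by move=> a; rewrite !inE => /or4P[] /eqP->.
- by move=> a; rewrite !inE => /or4P[] /eqP->; rewrite -?e2 -?e1.
by move: (R3 g g1 g2); rewrite g3.
Qed.

(** * From grid lines to collinearity of integer points *)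

Definition zpt (n : nat) (x : grid n) : zpoint :=
  (Z.of_nat x.1.1, Z.of_nat x.1.2, Z.of_nat x.2).

Lemma base_collinear (n : nat) (v x y z : grid n) :
  base v x = base v y -> base v y = base v z -> collinear (zpt x) (zpt y) (zpt z).
Proof.
move=> e1 e2; have [a1 a2 a3] := on_ray_base v x.
have [b1 b2 b3] := on_ray_base v y; have [c1 c2 c3] := on_ray_base v z.
rewrite e1 in a1 a2 a3; rewrite -e2 in c1 c2 c3.
rewrite /zpt /= a1 a2 a3 b1 b2 b3 c1 c2 c3.
by split; [|split]; lia.
Qed.

(** [v.1.1] divides [a] times each coordinate of [v], hence [a] times their gcd, which is [1]. *)
Lemma primitive_multiple (n : nat) (v : grid n) (a b c : nat) :
  primitive v -> a * v.1.2 = b * v.1.1 -> a * v.2 = c * v.1.1 ->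
  exists t, [/\ a = t * v.1.1, b = t * v.1.2 & c = t * v.2].
Proof.
move=> /and4P[v1 v2 v3 /eqP g] e1 e2.
have /dvdnP[t ta] : v.1.1 %| a.
  rewrite -[a]muln1 -g !muln_gcdr !dvdn_gcd e1 e2 !dvdn_mull //.
exists t; split=> //; apply/eqP; rewrite -(eqn_pmul2r v1).
  by rewrite -e1 ta mulnAC.
by rewrite -e2 ta mulnAC.
Qed.

(** Exactness of a triple concerns every collinear point; primitivity ensures that such a point
    differs from [x] by an integer multiple of [v]. *)
Lemma collinear_base (n : nat) (v x y w : grid n) :
  primitive v -> x != y -> base v x = base v y -> collinear (zpt x) (zpt y) (zpt w) ->
  base v w = base v x.
Proof.
move=> pv xy e; have [a1 a2 a3] := on_ray_base v x; have [b1 b2 b3] := on_ray_base v y.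
rewrite -e in b1 b2 b3.
have ne : height v x <> height v y.
  by move=> h; move/eqP: xy; apply; apply: grid_eq; rewrite ?a1 ?a2 ?a3 ?b1 ?b2 ?b3 h.
have [v1 v2 v3 _] := and4P pv.
case=> [c1 [c2 c3]].
have d12 : (Z.of_nat v.1.1 * (Z.of_nat w.1.2 - Z.of_nat x.1.2) =
            Z.of_nat v.1.2 * (Z.of_nat w.1.1 - Z.of_nat x.1.1))%Z.
  apply: (Z.mul_reg_l _ _ (Z.of_nat (height v y) - Z.of_nat (height v x))%Z); first by lia.
  have r1 : (Z.of_nat y.1.1 - Z.of_nat x.1.1 =
    (Z.of_nat (height v y) - Z.of_nat (height v x)) * Z.of_nat v.1.1)%Z by lia.
  have r2 : (Z.of_nat y.1.2 - Z.of_nat x.1.2 =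
    (Z.of_nat (height v y) - Z.of_nat (height v x)) * Z.of_nat v.1.2)%Z by lia.
  by rewrite !Z.mul_assoc -r1 -r2.
have d13 : (Z.of_nat v.1.1 * (Z.of_nat w.2 - Z.of_nat x.2) =
            Z.of_nat v.2 * (Z.of_nat w.1.1 - Z.of_nat x.1.1))%Z.
  apply: (Z.mul_reg_l _ _ (Z.of_nat (height v y) - Z.of_nat (height v x))%Z); first by lia.
  have r1 : (Z.of_nat y.1.1 - Z.of_nat x.1.1 =
    (Z.of_nat (height v y) - Z.of_nat (height v x)) * Z.of_nat v.1.1)%Z by lia.
  have r2 : (Z.of_nat y.2 - Z.of_nat x.2 =
    (Z.of_nat (height v y) - Z.of_nat (height v x)) * Z.of_nat v.2)%Z by lia.
  by rewrite !Z.mul_assoc -r1 -r2.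
(* Coordinates are naturals, so the displacement is taken upwards or downwards; as [v] is positive,
   its three coordinates never have opposite signs. *)
case: (leqP x.1.1 w.1.1) => h1.
  have h2 : x.1.2 <= w.1.2 by nia.
  have h3 : x.2 <= w.2 by nia.
  have [||t [t1 t2 t3]] :=
    @primitive_multiple _ v (w.1.1 - x.1.1) (w.1.2 - x.1.2) (w.2 - x.2) pv.
  - by apply: Nat2Z.inj; rewrite !Nat2Z.inj_mul !Nat2Z.inj_sub; lia.
  - by apply: Nat2Z.inj; rewrite !Nat2Z.inj_mul !Nat2Z.inj_sub; lia.
  by apply: (@on_ray_base_eq _ _ _ _ t pv); split; lia.
have h2 : w.1.2 <= x.1.2 by nia.
have h3 : w.2 <= x.2 by nia.
have [||t [t1 t2 t3]] :=
  @primitive_multiple _ v (x.1.1 - w.1.1) (x.1.2 - w.1.2) (x.2 - w.2) pv.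
- by apply: Nat2Z.inj; rewrite !Nat2Z.inj_mul !Nat2Z.inj_sub; lia.
- by apply: Nat2Z.inj; rewrite !Nat2Z.inj_mul !Nat2Z.inj_sub; lia.
by symmetry; apply: (@on_ray_base_eq _ _ _ _ t pv); split; lia.
Qed.

Lemma In_mem (s : seq nat) (x : nat) : List.In x s <-> x \in s.
Proof.
elim: s => [|y s IH] //=; rewrite inE; split.
  by case=> [->|/IH->]; rewrite ?eqxx ?orbT.
by case/orP => [/eqP->|/IH]; [left | right].
Qed.

Lemma NoDup_uniq (s : seq nat) : List.NoDup s -> uniq s.
Proof.
elim=> [//|x t h _ IH] /=; rewrite IH andbT.
by apply/negP => /In_mem.
Qed.

Theorem exact_triples : exists c : nat, forall q l N : nat,
  (1 <= N)%coq_nat -> (1 <= l)%coq_nat -> (q <= Nat.pow 2 l)%coq_nat ->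
  (8 * l * N <= Nat.pow q 6)%coq_nat ->
  exists P : nat -> zpoint,
    (forall i j, (i < N)%coq_nat -> (j < N)%coq_nat -> P i = P j -> i = j) /\
    forall S : list nat, List.NoDup S -> (forall i, List.In i S -> (i < N)%coq_nat) ->
      (c * (l * l * Nat.pow q 5) <= length S)%coq_nat ->
      exists i j k, List.In i S /\ List.In j S /\ List.In k S /\ i <> j /\ j <> k /\ i <> k /\
        collinear (P i) (P j) (P k) /\
        forall t, (t < N)%coq_nat -> collinear (P i) (P j) (P t) -> t = i \/ t = j \/ t = k.
Proof.
have [c hc] := grid_selection; exists c => q l N N1 l1 q2 qN.
have powE a b : Nat.pow a b = expn a b by elim: b => //= b IH; rewrite expnS IH.
rewrite !powE in q2 qN *.
have [h [hinj hS]] :=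
  hc q l N (introT leP N1) (introT leP l1) (introT leP q2) (introT leP qN).
pose P i := if insub i is Some o then zpt (h (o : 'I_N)) else (0, 0, 0)%Z.
have PE (o : 'I_N) : P o = zpt (h o) by rewrite /P valK.
exists P; split.
  move=> i j /ltP iN /ltP jN; rewrite (PE (Ordinal iN)) (PE (Ordinal jN)) => -[e1 e2 e3].
  suff : Ordinal iN = Ordinal jN by case.
  by apply: hinj; apply: grid_eq; apply: Nat2Z.inj.
move=> S /NoDup_uniq uS SN; rewrite -/(size S) => big.
pose A := [set i : 'I_N | nat_of_ord i \in S].
have cA : size S <= #|A|.
  rewrite cardE -(size_map val); apply: uniq_leq_size => // i iS.
  have /ltP iN : (i < N)%coq_nat by apply: SN; apply/In_mem.
  by apply/mapP; exists (Ordinal iN); rewrite // mem_enum in_set.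
have [|v [i [j [k [pv [iA jA kA] /and3P[ij jk ik] [e1 e2] ex]]]]] := hS A.
  by apply: leq_trans cA; rewrite !expnS expn0 muln1 -!expnS; apply/leP.
rewrite !in_set in iA jA kA.
exists i, j, k; do 3 (split; first exact/In_mem).
split; first by move=> /val_inj e; rewrite e eqxx in ij.
split; first by move=> /val_inj e; rewrite e eqxx in jk.
split; first by move=> /val_inj e; rewrite e eqxx in ik.
rewrite !PE; split; first exact: base_collinear e1 e2.
move=> t /ltP tN; rewrite (PE (Ordinal tN)) => col.
have := ex (Ordinal tN) (collinear_base pv _ e1 col).
rewrite (inj_eq hinj) => /(_ ij) /or3P[] /eqP /(congr1 val) /= ->; tauto.
Qed.

End GridTriples.

(** * From collinear triples to triangular cells *)

Lemma bounded_family (N : nat) (f : nat -> Z) :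
  exists B : Z, (0 <= B)%Z /\ forall i, (i < N)%nat -> (Z.abs (f i) <= B)%Z.
Proof.
  induction N as [|N [B [B0 HB]]].
  - exists 0%Z; split; [lia | intros i Hi; lia].
  - exists (Z.max B (Z.abs (f N))); split; [lia|].
    intros i Hi; destruct (Nat.eq_dec i N) as [->|]; [lia|].
    specialize (HB i ltac:(lia)); lia.
Qed.

Lemma small_multiple_zero (T a b : Z) : (Z.abs b < T)%Z -> (T * a = b)%Z -> a = 0%Z.
Proof. nia. Qed.

Lemma base_expansion_zero (T a b c : Z) :
  (Z.abs a < T)%Z -> (Z.abs b < T)%Z -> (Z.abs c < T)%Z ->
  (T * T * a - T * b + c = 0)%Z -> a = 0%Z /\ b = 0%Z /\ c = 0%Z.
Proof.
  intros Ha Hb Hc H.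
  assert (E : (c = T * (b - T * a))%Z) by lia.
  assert (b - T * a = 0)%Z by nia.
  assert (a = 0)%Z by nia.
  subst; lia.
Qed.

(** The planar determinant is [T ^ 2 * m12 - T * m13 + m23] in the minors of the spatial
    displacements. With [T] above every minor these act as digits and vanish together. Adding
    [c * Y] is a shear: it keeps the determinant and makes the abscissas distinct. *)
Lemma generic_projection (N : nat) (P : nat -> zpoint) :
  (forall i j, (i < N)%nat -> (j < N)%nat -> P i = P j -> i = j) ->
  exists X Y : nat -> Z,
    (forall i j, (i < N)%nat -> (j < N)%nat -> X i = X j -> i = j) /\
    (forall i j k, (i < N)%nat -> (j < N)%nat -> (k < N)%nat ->
       ((X j - X i) * (Y k - Y i) - (X k - X i) * (Y j - Y i) = 0)%Z <->
       collinear (P i) (P j) (P k)).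
Proof.
  intros inj.
  pose (p1 i := fst (fst (P i))); pose (p2 i := snd (fst (P i))); pose (p3 i := snd (P i)).
  destruct (bounded_family N p1) as [B1 [B10 H1]].
  destruct (bounded_family N p2) as [B2 [B20 H2]].
  destruct (bounded_family N p3) as [B3 [B30 H3]].
  set (B := (B1 + B2 + B3)%Z).
  assert (B0 : (0 <= B)%Z) by (unfold B; lia).
  set (T := (8 * B * B + 4 * B + 1)%Z).
  pose (U i := (T * p1 i - p2 i)%Z); pose (Y i := (T * p2 i - p3 i)%Z).
  destruct (bounded_family N U) as [C [C0 HC]].
  (* This exceeds every difference of two values of [U], so equal abscissas force equal [Y]. *)
  pose (c := (2 * C + 1)%Z).
  assert (small : forall i j, (i < N)%nat -> (j < N)%nat ->
    (Z.abs (p1 j - p1 i) <= 2 * B)%Z /\ (Z.abs (p2 j - p2 i) <= 2 * B)%Z /\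
    (Z.abs (p3 j - p3 i) <= 2 * B)%Z).
  { intros i j Hi Hj.
    pose proof (H1 i Hi); pose proof (H1 j Hj); pose proof (H2 i Hi); pose proof (H2 j Hj).
    pose proof (H3 i Hi); pose proof (H3 j Hj); unfold B; lia. }
  assert (minor : forall a b d e : Z, (Z.abs a <= 2 * B)%Z -> (Z.abs b <= 2 * B)%Z ->
    (Z.abs d <= 2 * B)%Z -> (Z.abs e <= 2 * B)%Z -> (Z.abs (a * d - b * e) < T)%Z).
  { intros a b d e Ha Hb Hd He.
    assert (Z.abs (a * d) <= 4 * B * B)%Z by (rewrite Z.abs_mul; nia).
    assert (Z.abs (b * e) <= 4 * B * B)%Z by (rewrite Z.abs_mul; nia).
    unfold T; lia. }
  exists (fun i => (U i + c * Y i)%Z), Y; split.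
  - intros i j Hi Hj E.
    pose proof (HC i Hi); pose proof (HC j Hj).
    assert (EY : Y i = Y j) by (unfold c in E; nia).
    assert (EU : U i = U j) by (rewrite EY in E; lia).
    destruct (small i j Hi Hj) as (s1 & s2 & s3).
    unfold U, Y in EU, EY.
    assert (T * (p1 j - p1 i) = p2 j - p2 i)%Z by lia.
    assert (T * (p2 j - p2 i) = p3 j - p3 i)%Z by lia.
    assert (HT : (2 * B < T)%Z) by (unfold T; clearbody B; clear - B0; nia).
    assert (p1 j - p1 i = 0)%Z by (eapply small_multiple_zero; [|eassumption]; lia).
    assert (p2 j - p2 i = 0)%Z by (eapply small_multiple_zero; [|eassumption]; lia).
    assert (p3 j - p3 i = 0)%Z by lia.
    apply inj; trivial.
    apply injective_projections; [apply injective_projections|]; unfold p1, p2, p3 in *; lia.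
  - intros i j k Hi Hj Hk.
    destruct (small i j Hi Hj) as (s1 & s2 & s3).
    destruct (small i k Hi Hk) as (r1 & r2 & r3).
    assert (E : forall D : Prop,
      ((((p1 j - p1 i) * (p2 k - p2 i) = (p2 j - p2 i) * (p1 k - p1 i))%Z /\
       ((p1 j - p1 i) * (p3 k - p3 i) = (p3 j - p3 i) * (p1 k - p1 i))%Z /\
       ((p2 j - p2 i) * (p3 k - p3 i) = (p3 j - p3 i) * (p2 k - p2 i))%Z) <-> D) ->
      collinear (P i) (P j) (P k) <-> D).
    { intros D; unfold p1, p2, p3, collinear.
      destruct (P i) as [[? ?] ?], (P j) as [[? ?] ?], (P k) as [[? ?] ?]; simpl; tauto. }
    symmetry; apply E; split.
    + intros (e1 & e2 & e3); unfold U, Y.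
      assert (K : (T * T * ((p1 j - p1 i) * (p2 k - p2 i) - (p2 j - p2 i) * (p1 k - p1 i))
        - T * ((p1 j - p1 i) * (p3 k - p3 i) - (p3 j - p3 i) * (p1 k - p1 i))
        + ((p2 j - p2 i) * (p3 k - p3 i) - (p3 j - p3 i) * (p2 k - p2 i)) = 0)%Z)
        by (rewrite e1, e2, e3; ring).
      rewrite <- K; ring.
    + intros H.
      assert (K : (T * T * ((p1 j - p1 i) * (p2 k - p2 i) - (p2 j - p2 i) * (p1 k - p1 i))
        - T * ((p1 j - p1 i) * (p3 k - p3 i) - (p3 j - p3 i) * (p1 k - p1 i))
        + ((p2 j - p2 i) * (p3 k - p3 i) - (p3 j - p3 i) * (p2 k - p2 i)) = 0)%Z)
        by (rewrite <- H; unfold U, Y; ring).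
      apply base_expansion_zero in K; [lia | apply minor; assumption ..].
Qed.

(** Asking for all smaller [e'] as well lets finitely many thresholds be replaced by their
    minimum. *)
Lemma eventually_forall (N : nat) (Q : nat -> R -> Prop) :
  (forall i, (i < N)%nat -> exists e, 0 < e /\ forall e', 0 < e' <= e -> Q i e') ->
  exists e, 0 < e /\ forall e', 0 < e' <= e -> forall i, (i < N)%nat -> Q i e'.
Proof.
  induction N as [|N IH]; intros H.
  - exists 1; split; [lra|]; intros; lia.
  - destruct IH as [e [e0 He]]; [intros i Hi; apply H; lia|].
    destruct (H N ltac:(lia)) as [d [d0 Hd]].
    exists (Rmin e d); split; [apply Rmin_glb_lt; assumption|].
    intros e' [h1 h2] i Hi.
    pose proof (Rmin_l e d); pose proof (Rmin_r e d).
    destruct (Nat.eq_dec i N) as [->|]; [apply Hd; lra | apply He; [lra | lia]].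
Qed.

Lemma eventually_mul_lt (m d : R) :
  0 < d -> exists e, 0 < e /\ forall e', 0 < e' <= e -> e' * Rabs m < d.
Proof.
  intros d0; pose proof (Rabs_pos m).
  exists (d / (Rabs m + 1)); split; [apply Rdiv_lt_0_compat; lra|].
  intros e' [h1 h2].
  apply Rle_lt_trans with (d / (Rabs m + 1) * Rabs m).
  - apply Rmult_le_compat_r; lra.
  - apply Rmult_lt_reg_r with (Rabs m + 1); [lra|].
    unfold Rdiv; replace (d * / (Rabs m + 1) * Rabs m * (Rabs m + 1)) with (d * Rabs m)
      by (field; lra).
    nra.
Qed.

(** * Perturbed dual lines and their triangular cells *)

Definition det (x y : nat -> R) (i j k : nat) : R :=
  (x j - x i) * (y k - y i) - (x k - x i) * (y j - y i).

(* Dual line of the point [(x, y)], pushed off by [e * x^2]: the Vandermonde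
   determinant then separates every concurrent triple. *)
Definition dual_line (x y e : R) : line :=
  mkLine (- x) 1 (y + e * x * x) (or_intror R1_neq_R0).

(** Signed vertical distance from the dual line to [p]; its sign tells the side. *)
Definition offset (x y e : R) (p : pt) : R := snd p - x * fst p - y - e * x * x.

Lemma on_dual_line (x y e : R) (p : pt) :
  on_line (dual_line x y e) p <-> offset x y e p = 0.
Proof. unfold on_line, offset; simpl; split; intros; lra. Qed.

Definition dual_arr (N : nat) (x y : nat -> R) (e : R) : list line :=
  map (fun i => dual_line (x i) (y i) e) (seq 0 N).

Lemma length_dual_arr N x y e : length (dual_arr N x y e) = N.
Proof. unfold dual_arr; rewrite length_map, length_seq; reflexivity. Qed.

Lemma lin_dual_arr N x y e i :
  (i < N)%nat -> lin (dual_arr N x y e) i = dual_line (x i) (y i) e.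
Proof.
  intros Hi; unfold lin, dual_arr.
  set (f := fun i => dual_line (x i) (y i) e); change (nth i (map f (seq 0 N)) dflt_line = f i).
  rewrite nth_indep with (d' := f 0%nat)
    by (rewrite length_map, length_seq; exact Hi).
  rewrite map_nth, seq_nth by exact Hi; reflexivity.
Qed.

(** The combination cancels both coordinates of [p] and leaves the concurrency determinant plus the
    Vandermonde product produced by the quadratic push. *)
Lemma offset_relation (x y : nat -> R) (e : R) (p : pt) (i j k : nat) :
  (x k - x j) * offset (x i) (y i) e p - (x k - x i) * offset (x j) (y j) e p
  + (x j - x i) * offset (x k) (y k) e p =
  - (det x y i j k + e * ((x j - x i) * (x k - x i) * (x k - x j))).
Proof. unfold offset, det; ring. Qed.

Lemma same_cell_offset N x y e p q i :
  (i < N)%nat -> same_cell (dual_arr N x y e) p q ->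
  0 < offset (x i) (y i) e p * offset (x i) (y i) e q.
Proof.
  intros Hi (_ & _ & g & c1 & c2 & g0 & g1 & off).
  apply Rnot_le_lt; intros H.
  pose (phi := fun t => offset (x i) (y i) e (g t)).
  assert (cphi : continuity phi).
  { intros t; unfold phi, offset.
    apply continuity_pt_minus; [|apply continuity_pt_const; intros ? ?; reflexivity].
    apply continuity_pt_minus; [|apply continuity_pt_const; intros ? ?; reflexivity].
    apply continuity_pt_minus; [apply c2|].
    apply continuity_pt_mult; [apply continuity_pt_const; intros ? ?; reflexivity | apply c1]. }
  destruct (IVT_cor phi 0 1 cphi ltac:(lra)) as [z [Hz Ez]].
  { unfold phi; rewrite g0, g1; exact H. }
  apply (off z Hz i); [rewrite length_dual_arr; exact Hi|].
  rewrite lin_dual_arr by exact Hi; apply on_dual_line; exact Ez.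
Qed.

Lemma closure_offset N x y e p z i :
  (i < N)%nat -> in_closure_cell (dual_arr N x y e) p z ->
  0 <= offset (x i) (y i) e p * offset (x i) (y i) e z.
Proof.
  intros Hi Hz; apply Rnot_lt_le; intros H.
  set (a := offset (x i) (y i) e p) in *; set (b := offset (x i) (y i) e z) in *.
  pose proof (Rabs_pos (x i)) as x0.
  assert (b0 : b <> 0) by (intros E; rewrite E in H; lra).
  assert (b1 : 0 < Rabs b) by (apply Rabs_pos_lt; exact b0).
  (* Moving each coordinate by less than this changes the offset by less than [Rabs b], so it keeps
     the sign of [b]. *)
  destruct (Hz (Rabs b / (1 + Rabs (x i)))) as [q [sc [h1 h2]]].
  { apply Rdiv_lt_0_compat; lra. }
  pose proof (same_cell_offset N x y e p q i Hi sc) as Hq; fold a in Hq.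
  assert (D : Rabs (offset (x i) (y i) e q - b) < Rabs b).
  { unfold b at 1, offset.
    replace (snd q - x i * fst q - y i - e * x i * x i
      - (snd z - x i * fst z - y i - e * x i * x i))
      with ((snd q - snd z) + - (x i * (fst q - fst z))) by ring.
    eapply Rle_lt_trans; [apply Rabs_triang|].
    rewrite Rabs_Ropp, Rabs_mult.
    set (r := Rabs b / (1 + Rabs (x i))) in *.
    assert (r * (1 + Rabs (x i)) = Rabs b) by (unfold r; field; lra).
    pose proof (Rabs_pos (fst q - fst z)).
    nra. }
  apply Rabs_def2 in D.
  unfold Rabs in D; destruct (Rcase_abs b); nra.
Qed.

Lemma nonneg_of_mul_sqr (s t : R) : t <> 0 -> 0 <= s * t * t -> 0 <= s.
Proof.
  intros t0 Hst; pose proof (Rsqr_pos_lt t t0) as H; unfold Rsqr in H.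
  apply Rnot_lt_le; intros Hs; nra.
Qed.

(** The sign conditions describe the closed triangle cut out by lines [i], [j], [k]. If line [l] met
    it, the offset relation would make [det x y i j l] of order [e], against the smallness of
    [e]. *)
Lemma small_triangle (x y : nat -> R) (e : R) (i j k l : nat) (p : pt) :
  x i <> x j -> x j <> x k -> x i <> x k -> 0 < e -> det x y i j k = 0 ->
  e * Rabs (Rabs ((x j - x i) * (x l - x i) * (x l - x j))
    + Rabs ((x l - x j) * ((x j - x i) * (x k - x i)))
    + Rabs ((x l - x i) * ((x j - x i) * (x k - x j)))) < Rabs (det x y i j l) ->
  offset (x i) (y i) e p * ((x k - x i) * (x j - x i)) <= 0 ->
  0 <= offset (x j) (y j) e p * ((x k - x j) * (x j - x i)) ->
  offset (x k) (y k) e p * ((x k - x j) * (x k - x i)) <= 0 ->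
  offset (x l) (y l) e p <> 0.
Proof.
  intros ij jk ik e0 dijk small si sj sk El.
  pose proof (offset_relation x y e p i j k) as R1.
  pose proof (offset_relation x y e p i j l) as R2.
  rewrite El in R2; rewrite dijk in R1.
  revert R1 R2 si sj sk.
  set (fi := offset (x i) _ _ _); set (fj := offset (x j) _ _ _); set (fk := offset (x k) _ _ _).
  intros R1 R2 si sj sk.
  pose (a := x k - x j); pose (b := x k - x i); pose (c := x j - x i).
  fold a b c in R1, R2, si, sj, sk, small |- *.
  assert (a0 : a <> 0) by (unfold a; lra).
  assert (b0 : b <> 0) by (unfold b; lra).
  assert (c0 : c <> 0) by (unfold c; lra).
  (* barycentric coordinates: nonnegative, summing to [e] *)
  pose (u := - fi / (b * c)); pose (v := fj / (a * c)); pose (w := - fk / (a * b)).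
  assert (Hu : fi = - u * (b * c)) by (unfold u; field; auto).
  assert (Hv : fj = v * (a * c)) by (unfold v; field; auto).
  assert (Hw : fk = - w * (a * b)) by (unfold w; field; auto).
  assert (u0 : 0 <= u).
  { apply (nonneg_of_mul_sqr u (b * c)); [apply Rmult_integral_contrapositive; auto|].
    rewrite Hu in si; lra. }
  assert (v0 : 0 <= v).
  { apply (nonneg_of_mul_sqr v (a * c)); [apply Rmult_integral_contrapositive; auto|].
    rewrite Hv in sj; lra. }
  assert (w0 : 0 <= w).
  { apply (nonneg_of_mul_sqr w (a * b)); [apply Rmult_integral_contrapositive; auto|].
    rewrite Hw in sk; lra. }
  assert (sum : u + v + w = e).
  { apply Rmult_eq_reg_r with (a * b * c);
      [|repeat apply Rmult_integral_contrapositive_currified; auto].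
    rewrite Hu, Hv, Hw in R1; lra. }
  assert (bound : forall s t, 0 <= s <= e -> Rabs (s * t) <= e * Rabs t).
  { intros s t [h1 h2]; rewrite Rabs_mult, (Rabs_right s) by lra.
    apply Rmult_le_compat_r; [apply Rabs_pos | lra]. }
  assert (E : det x y i j l = - (e * (c * (x l - x i) * (x l - x j)))
     + u * ((x l - x j) * (c * b)) + v * ((x l - x i) * (c * a))).
  { rewrite Hu, Hv in R2; lra. }
  apply (Rlt_irrefl (Rabs (det x y i j l))).
  eapply Rle_lt_trans; [|exact small].
  rewrite E at 1.
  eapply Rle_trans; [apply Rabs_triang|].
  eapply Rle_trans; [apply Rplus_le_compat_r, Rabs_triang|].
  rewrite Rabs_Ropp.
  pose proof (bound e (c * (x l - x i) * (x l - x j)) ltac:(lra)).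
  pose proof (bound u ((x l - x j) * (c * b)) ltac:(lra)).
  pose proof (bound v ((x l - x i) * (c * a)) ltac:(lra)).
  rewrite (Rabs_right (_ + _ + _)); [lra|].
  pose proof (Rabs_pos (c * (x l - x i) * (x l - x j))).
  pose proof (Rabs_pos ((x l - x j) * (c * b))).
  pose proof (Rabs_pos ((x l - x i) * (c * a))).
  lra.
Qed.

(** The centroid: all barycentric coordinates equal [e / 3]. Two offsets fix the point and the
    relation forces the third. *)
Lemma triangle_center (x y : nat -> R) (e : R) (i j k : nat) :
  x i <> x j -> det x y i j k = 0 ->
  exists p, offset (x i) (y i) e p = - (e / 3 * ((x k - x i) * (x j - x i))) /\
    offset (x j) (y j) e p = e / 3 * ((x k - x j) * (x j - x i)) /\
    offset (x k) (y k) e p = - (e / 3 * ((x k - x j) * (x k - x i))).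
Proof.
  intros ij d0.
  pose (al := - (e / 3 * ((x k - x i) * (x j - x i)))).
  pose (be := e / 3 * ((x k - x j) * (x j - x i))).
  pose (s := (al - be - (y j + e * x j * x j - y i - e * x i * x i)) / (x j - x i)).
  pose (p := (s, x i * s + y i + e * x i * x i + al)).
  assert (E1 : offset (x i) (y i) e p = al) by (unfold p, offset; simpl; ring).
  assert (E2 : offset (x j) (y j) e p = be) by (unfold p, offset, s; simpl; field; lra).
  exists p; split; [exact E1 | split; [exact E2|]].
  pose proof (offset_relation x y e p i j k) as H; rewrite E1, E2, d0 in H.
  apply Rmult_eq_reg_l with (x j - x i); [|lra].
  unfold al, be in H; lra.
Qed.

Theorem exact_triple_cells (N : nat) (P : nat -> zpoint) :
  (forall i j, (i < N)%nat -> (j < N)%nat -> P i = P j -> i = j) ->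
  exists L, length L = N /\ simple_arr L /\
    forall i j k, (i < N)%nat -> (j < N)%nat -> (k < N)%nat ->
      i <> j -> j <> k -> i <> k -> collinear (P i) (P j) (P k) ->
      (forall t, (t < N)%nat -> collinear (P i) (P j) (P t) -> t = i \/ t = j \/ t = k) ->
      exists p, off_lines L p /\
        forall S : nat -> Prop, S i -> S j -> S k -> hyperedge_in L p S.
Proof.
  intros inj; destruct (generic_projection N P inj) as (X & Y & Xinj & col).
  pose (x i := IZR (X i)); pose (y i := IZR (Y i)).
  assert (xinj : forall i j, (i < N)%nat -> (j < N)%nat -> i <> j -> x i <> x j).
  { intros i j Hi Hj ij E; apply ij, Xinj; trivial; apply eq_IZR, E. }
  assert (detcol : forall i j k, (i < N)%nat -> (j < N)%nat -> (k < N)%nat ->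
    det x y i j k = 0 <-> collinear (P i) (P j) (P k)).
  { intros i j k Hi Hj Hk; rewrite <- (col i j k Hi Hj Hk).
    unfold det, x, y; rewrite <- !minus_IZR, <- !mult_IZR, <- minus_IZR.
    split; [apply eq_IZR | intros ->; reflexivity]. }
  pose (M i j k l := Rabs ((x j - x i) * (x l - x i) * (x l - x j))
    + Rabs ((x l - x j) * ((x j - x i) * (x k - x i)))
    + Rabs ((x l - x i) * ((x j - x i) * (x k - x j)))).
  (* A single [e] must serve all triples, since the arrangement is fixed before they are given. *)
  assert (exists e, 0 < e /\ forall i, (i < N)%nat -> forall j, (j < N)%nat ->
    forall k, (k < N)%nat -> forall l, (l < N)%nat ->
    det x y i j l <> 0 -> e * Rabs (M i j k l) < Rabs (det x y i j l)) as (e & e0 & He).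
  { assert (exists e, 0 < e /\ forall e', 0 < e' <= e ->
      forall i, (i < N)%nat -> forall j, (j < N)%nat ->
      forall k, (k < N)%nat -> forall l, (l < N)%nat ->
      det x y i j l <> 0 -> e' * Rabs (M i j k l) < Rabs (det x y i j l)) as (e & e0 & He).
    { apply eventually_forall; intros i _; apply eventually_forall; intros j _.
      apply eventually_forall; intros k _; apply eventually_forall; intros l _.
      destruct (classic (det x y i j l = 0)) as [E|E].
      - exists 1; split; [lra | intros; contradiction].
      - destruct (eventually_mul_lt (M i j k l) (Rabs (det x y i j l))) as (e & e0 & He).
        + apply Rabs_pos_lt; exact E.
        + exists e; split; [exact e0 | intros; apply He; assumption]. }
    exists e; split; [exact e0 | apply He; lra]. }
  exists (dual_arr N x y e).
  split; [apply length_dual_arr|]. split; [split|].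
  - rewrite length_dual_arr; intros i j Hi Hj ij.
    rewrite !lin_dual_arr by assumption; unfold parallel; simpl; intros E.
    apply (xinj i j Hi Hj ij); lra.
  - rewrite length_dual_arr; intros i j k p Hi Hj Hk ij jk ik.
    rewrite !lin_dual_arr by assumption; rewrite !on_dual_line; intros (E1 & E2 & E3).
    pose proof (offset_relation x y e p i j k) as H; rewrite E1, E2, E3 in H.
    pose proof (xinj i j Hi Hj ij); pose proof (xinj j k Hj Hk jk); pose proof (xinj i k Hi Hk ik).
    set (V := (x j - x i) * (x k - x i) * (x k - x j)) in *.
    assert (V0 : V <> 0) by (unfold V; repeat apply Rmult_integral_contrapositive_currified; lra).
    assert (D : det x y i j k = - (e * V)) by lra.
    assert (D0 : det x y i j k <> 0) by (rewrite D; nra).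
    (* The instance [l = k]: the first summand of [M i j k k] is [Rabs V], so [e * Rabs V] would be
       less than itself. *)
    specialize (He i Hi j Hj k Hk k Hk D0).
    rewrite D, Rabs_Ropp, Rabs_mult, (Rabs_right e) in He by lra.
    assert (Rabs V <= Rabs (M i j k k)); [|nra].
    unfold M; fold V.
    rewrite (Rabs_right (_ + _ + _)).
    + pose proof (Rabs_pos ((x k - x j) * ((x j - x i) * (x k - x i)))).
      pose proof (Rabs_pos ((x k - x i) * ((x j - x i) * (x k - x j)))). lra.
    + pose proof (Rabs_pos V).
      pose proof (Rabs_pos ((x k - x j) * ((x j - x i) * (x k - x i)))).
      pose proof (Rabs_pos ((x k - x i) * ((x j - x i) * (x k - x j)))). lra.
  - intros i j k Hi Hj Hk ij jk ik cijk excl.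
    pose proof (xinj i j Hi Hj ij) as xij; pose proof (xinj j k Hj Hk jk) as xjk.
    pose proof (xinj i k Hi Hk ik) as xik.
    apply detcol in cijk; trivial.
    destruct (triangle_center x y e i j k xij cijk) as (p & pi & pj & pk).
    set (A := (x k - x i) * (x j - x i)) in *.
    set (B := (x k - x j) * (x j - x i)) in *.
    set (C := (x k - x j) * (x k - x i)) in *.
    assert (A0 : A <> 0) by (unfold A; apply Rmult_integral_contrapositive_currified; lra).
    assert (B0 : B <> 0) by (unfold B; apply Rmult_integral_contrapositive_currified; lra).
    assert (C0 : C <> 0) by (unfold C; apply Rmult_integral_contrapositive_currified; lra).
    assert (sq : forall r, 0 <= r * r) by (intros r; nra).
    (* No other line meets the closed triangle, which contains the closure of the cell. *)
    assert (far : forall l q, (l < N)%nat -> l <> i -> l <> j -> l <> k ->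
      0 <= offset (x i) (y i) e p * offset (x i) (y i) e q ->
      0 <= offset (x j) (y j) e p * offset (x j) (y j) e q ->
      0 <= offset (x k) (y k) e p * offset (x k) (y k) e q ->
      offset (x l) (y l) e q <> 0).
    { intros l q Hl li lj lk s1 s2 s3.
      apply (small_triangle x y e i j k l q); trivial.
      - apply He; trivial; intros E; apply detcol in E; trivial.
        destruct (excl l Hl E) as [|[|]]; congruence.
      - fold A; rewrite pi in s1; nra.
      - fold B; rewrite pj in s2; nra.
      - fold C; rewrite pk in s3; nra. }
    exists p; split.
    + intros l; rewrite length_dual_arr; intros Hl.
      rewrite lin_dual_arr, on_dual_line by exact Hl.
      destruct (Nat.eq_dec l i) as [->|li]; [rewrite pi; nra|].
      destruct (Nat.eq_dec l j) as [->|lj]; [rewrite pj; nra|].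
      destruct (Nat.eq_dec l k) as [->|lk]; [rewrite pk; nra|].
      apply far; trivial.
    + intros S Si Sj Sk l; rewrite length_dual_arr; intros Hl (a & b & _ & onl & _ & clo).
      destruct (Nat.eq_dec l i) as [->|li]; [exact Si|].
      destruct (Nat.eq_dec l j) as [->|lj]; [exact Sj|].
      destruct (Nat.eq_dec l k) as [->|lk]; [exact Sk|].
      exfalso; specialize (clo 0 ltac:(lra)).
      rewrite lin_dual_arr in onl by exact Hl; apply on_dual_line in onl.
      replace (fst a + 0 * (fst b - fst a), snd a + 0 * (snd b - snd a)) with a in clo
        by (destruct a; simpl; f_equal; ring).
      apply (far l a Hl li lj lk); try exact onl; apply (closure_offset N); assumption.
Qed.

(** * Asymptotics and colorings *)

(** Rounding the sixth root up at most doubles it, whence [64 = 2 ^ 6]. *)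
Lemma sixth_root (A : nat) : (1 <= A)%nat ->
  exists q, (A <= q ^ 6)%nat /\ (q ^ 6 <= 64 * A)%nat.
Proof.
  intros HA.
  assert (exists q, (q ^ 6 <= A < (S q) ^ 6)%nat) as [q [h1 h2]].
  { clear HA; induction A as [|A [q [h1 h2]]].
    - exists 0%nat; simpl; lia.
    - destruct (Nat.lt_ge_cases (S A) (S q ^ 6)) as [h|h].
      + exists q; lia.
      + exists (S q); split; [exact h|].
        apply Nat.le_lt_trans with (S q ^ 6)%nat; [lia|].
        apply Nat.pow_lt_mono_l; lia. }
  exists (S q); split; [lia|].
  destruct q as [|q]; [simpl in h2; lia|].
  apply Nat.le_trans with ((2 * S q) ^ 6)%nat; [apply Nat.pow_le_mono_l; lia|].
  rewrite Nat.pow_mul_l; change (2 ^ 6)%nat with 64%nat; lia.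
Qed.

Definition loglen (N : nat) : nat := S (Nat.log2 N).

(* The exponent [eps n] is chosen so that [n^(eps n) = slack c n]. *)
Definition slack (c N : nat) : R := 512 * (INR c + 1) * INR (loglen N) ^ 3.

Lemma loglen_ge1 (N : nat) : 1 <= INR (loglen N).
Proof. unfold loglen; rewrite S_INR; pose proof (pos_INR (Nat.log2 N)); lra. Qed.

Lemma slack_ge (c N : nat) : 512 <= slack c N.
Proof.
  unfold slack; pose proof (loglen_ge1 N) as Hl; pose proof (pos_INR c).
  assert (1 <= INR (loglen N) ^ 3) by (apply pow_R1_Rle; exact Hl). nra.
Qed.

(** As [q ^ 6] lies between [8 * l * N] and [512 * l * N], the threshold has order
    [l ^ 3 * N ^ (5/6)], and [slack] supplies the factor [l ^ 3] and the constants. *)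
Lemma parameters (c N : nat) : (4 <= N)%nat ->
  exists q l : nat, (1 <= l)%nat /\ (q <= 2 ^ l)%nat /\ (8 * l * N <= q ^ 6)%nat /\
    INR (c * (l * l * q ^ 5)) <= slack c N * Rpower (INR N) (5/6).
Proof.
  intros HN; set (l := loglen N).
  assert (Hl : (3 <= l)%nat).
  { unfold l, loglen; pose proof (Nat.log2_le_mono 4 N HN) as H.
    change (Nat.log2 4) with 2%nat in H; lia. }
  assert (HNl : (N <= 2 ^ l)%nat).
  { pose proof (Nat.log2_spec N ltac:(lia)); unfold l, loglen; lia. }
  destruct (sixth_root (8 * l * N)) as [q [h1 h2]]; [nia|].
  assert (Hll : (l < 2 ^ l)%nat) by (apply Nat.pow_gt_lin_r; lia).
  exists q, l; split; [lia|]; split; [|split; [exact h1|]].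
  (* With [t = 2 ^ l], [q ^ 6 <= 512 * t ^ 2 <= t ^ 6]; the last step uses [t >= 8], which comes
     from [N >= 4]. *)
  - destruct (Nat.le_gt_cases q (2 ^ l)) as [h|h]; [exact h|exfalso].
    assert (h3 : ((2 ^ l) ^ 6 < q ^ 6)%nat) by (apply Nat.pow_lt_mono_l; lia).
    assert (h4 : (8 <= 2 ^ l)%nat).
    { change 8%nat with (2 ^ 3)%nat; apply Nat.pow_le_mono_r; lia. }
    set (t := (2 ^ l)%nat) in *.
    assert (h5 : (64 * (8 * l * N) <= 512 * (t * t))%nat) by nia.
    assert (h6 : (512 * (t * t) <= t ^ 6)%nat).
    { replace (t ^ 6)%nat with (t * t * t * t * (t * t))%nat by (simpl; ring).
      apply Nat.mul_le_mono_r. nia. }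
    lia.
  - assert (q0 : 0 < INR q).
    { apply lt_0_INR; destruct q; [simpl in h1; nia | lia]. }
    assert (N0 : 0 < INR N) by (apply lt_0_INR; lia).
    pose proof (loglen_ge1 N) as l1; fold l in l1.
    assert (B : INR q ^ 6 <= 512 * INR l * INR N).
    { rewrite <- pow_INR; eapply Rle_trans; [apply le_INR, h2|].
      rewrite !mult_INR; simpl; lra. }
    assert (E5 : INR q ^ 5 = Rpower (INR q ^ 6) (5/6)).
    { rewrite <- !Rpower_pow by exact q0; rewrite Rpower_mult; f_equal; simpl; lra. }
    assert (B5 : INR q ^ 5 <= 512 * INR l * Rpower (INR N) (5/6)).
    { rewrite E5; eapply Rle_trans.
      - apply Rle_Rpower_l; [lra|]; split; [apply pow_lt; exact q0 | exact B].
      - rewrite <- Rpower_mult_distr by nra.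
        apply Rmult_le_compat_r; [left; apply exp_pos|].
        rewrite <- (Rpower_1 (512 * INR l)) at 2 by lra.
        apply Rle_Rpower; lra. }
    rewrite !mult_INR, pow_INR; unfold slack; fold l.
    pose proof (pos_INR c) as c0.
    apply Rle_trans with (INR c * (INR l * INR l * (512 * INR l * Rpower (INR N) (5/6)))).
    + apply Rmult_le_compat_l; [exact c0|]. apply Rmult_le_compat_l; [nra | exact B5].
    + assert (0 < Rpower (INR N) (5/6)) by apply exp_pos.
      assert (0 <= INR l ^ 3 * Rpower (INR N) (5/6)).
      { apply Rmult_le_pos; [apply pow_le; lra | lra]. }
      simpl in *; nra.
Qed.

Lemma ln_le_2_sqrt (y : R) : 0 < y -> ln y <= 2 * sqrt y.
Proof.
  intros y0; pose proof (sqrt_lt_R0 y y0) as s0.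
  rewrite <- (sqrt_sqrt y) at 1 by lra.
  rewrite ln_mult by exact s0.
  pose proof (exp_ineq1_le (ln (sqrt y))) as H; rewrite exp_ln in H by exact s0; lra.
Qed.

Lemma loglen_le (N : nat) : (1 <= N)%nat -> INR (loglen N) <= 1 + 2 * ln (INR N).
Proof.
  intros HN; unfold loglen; rewrite S_INR.
  destruct (Nat.log2_spec N HN) as [h _]; apply le_INR in h; rewrite pow_INR in h.
  assert (p : 0 < INR 2 ^ Nat.log2 N) by (apply pow_lt; simpl; lra).
  assert (H : ln (INR 2 ^ Nat.log2 N) <= ln (INR N)).
  { destruct h as [h|h]; [left; apply ln_increasing; assumption | rewrite h; lra]. }
  rewrite ln_pow in H by (simpl; lra).
  pose proof ln_lt_2; pose proof (pos_INR (Nat.log2 N)); change (INR 2) with 2 in H; nra.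
Qed.

(** [slack] is polylogarithmic, so its logarithm is at most a constant plus a multiple of
    [sqrt (ln N)], which is negligible against [ln N]. *)
Lemma slack_exponent_cv (c : nat) : Un_cv (fun N => ln (slack c N) / ln (INR N)) 0.
Proof.
  intros d d0.
  set (C := 512 * (INR c + 1)); pose proof (pos_INR c) as c0.
  assert (C1 : 1 < C) by (unfold C; lra).
  assert (lC : 0 < ln C) by (rewrite <- ln_1; apply ln_increasing; lra).
  (* The last two terms make [ln C] and [6 * sqrt (3 * x)] each less than [d * x / 2]; here
     [432 = 12 ^ 2 * 3]. *)
  set (X := 1 + 2 * ln C / d + 432 / (d * d)).
  assert (t1 : 0 < 2 * ln C / d) by (apply Rdiv_lt_0_compat; lra).
  assert (t2 : 0 < 432 / (d * d)) by (apply Rdiv_lt_0_compat; nra).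
  destruct (archimed (exp X)) as [up1 _].
  exists (Z.to_nat (up (exp X))); intros N HN.
  assert (HX : exp X < INR N).
  { eapply Rlt_le_trans; [exact up1|]; rewrite INR_IZR_INZ; apply IZR_le; lia. }
  assert (N0 : 0 < INR N) by (pose proof (exp_pos X); lra).
  assert (N1 : (1 <= N)%nat) by (destruct N; [simpl in N0; lra | lia]).
  set (x := ln (INR N)).
  assert (xX : X < x).
  { unfold x; rewrite <- (ln_exp X); apply ln_increasing; [apply exp_pos | exact HX]. }
  assert (x1 : 1 < x) by (unfold X in xX; lra).
  pose proof (loglen_ge1 N) as l1; pose proof (loglen_le N N1) as l2; fold x in l2.
  assert (lnl : ln (INR (loglen N)) <= 2 * sqrt (3 * x)).
  { eapply Rle_trans; [|apply ln_le_2_sqrt; lra].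
    destruct (Req_dec (INR (loglen N)) (3 * x)) as [->|]; [lra|].
    left; apply ln_increasing; lra. }
  assert (K : ln (slack c N) = ln C + 3 * ln (INR (loglen N))).
  { unfold slack; fold C; rewrite ln_mult; [|lra | apply pow_lt; lra].
    rewrite ln_pow by lra; simpl; lra. }
  assert (K0 : 0 <= ln (slack c N)).
  { pose proof (slack_ge c N); rewrite <- ln_1; left; apply ln_increasing; lra. }
  assert (s1 : 2 * ln C < d * x).
  { replace (2 * ln C) with (d * (2 * ln C / d)) by (field; lra).
    apply Rmult_lt_compat_l; unfold X in xX; lra. }
  assert (s2 : 12 * sqrt (3 * x) < d * x).
  { rewrite <- (sqrt_square (d * x)) by nra.
    replace 12 with (sqrt (12 * 12)) by (apply sqrt_square; lra).
    rewrite <- sqrt_mult by lra.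
    apply sqrt_lt_1; [lra | nra |].
    assert (432 < d * d * x).
    { replace 432 with (d * d * (432 / (d * d))) by (field; lra).
      apply Rmult_lt_compat_l; unfold X in xX; [nra | lra]. }
    nra. }
  unfold Rdist; rewrite Rminus_0_r, Rabs_right.
  - apply Rmult_lt_reg_r with x; [lra|].
    unfold Rdiv; rewrite Rmult_assoc, Rinv_l by lra. rewrite K; lra.
  - apply Rle_ge, Rmult_le_pos; [exact K0 | left; apply Rinv_0_lt_compat; lra].
Qed.

(** * From large sets of lines to colorings *)

Lemma filter_pigeonhole (col : nat -> nat) (b : R) (k : nat) (s : list nat) :
  0 <= b -> (forall i, In i s -> (col i < k)%nat) ->
  (forall c, INR (length (filter (fun i => Nat.eqb (col i) c) s)) <= b) ->
  INR (length s) <= INR k * b.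
Proof.
  intros b0; revert s; induction k as [|k IH]; intros s Hs Hb.
  - destruct s as [|i s]; [simpl; lra|]. specialize (Hs i (or_introl eq_refl)); lia.
  - set (s' := filter (fun i => Nat.ltb (col i) k) s).
    assert (E : forall u : list nat, (forall i, In i u -> (col i < S k)%nat) ->
      length u = (length (filter (fun i => Nat.ltb (col i) k) u)
                 + length (filter (fun i => Nat.eqb (col i) k) u))%nat).
    { induction u as [|i u IHu]; intros Hu; [reflexivity|]; simpl.
      pose proof (Hu i (or_introl eq_refl)).
      rewrite IHu by (intros j Hj; apply Hu; right; exact Hj).
      destruct (Nat.ltb_spec (col i) k), (Nat.eqb_spec (col i) k); simpl; lia. }
    rewrite (E s Hs), plus_INR, S_INR; fold s'.
    assert (INR (length s') <= INR k * b).
    { apply IH.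
      - intros i Hi; apply filter_In in Hi; destruct Hi as [_ Hi].
        apply Nat.ltb_lt; exact Hi.
      - intros c; eapply Rle_trans; [|apply (Hb c)]; apply le_INR.
        assert (F : forall u : list nat,
          (length (filter (fun i => Nat.eqb (col i) c) (filter (fun i => Nat.ltb (col i) k) u))
           <= length (filter (fun i => Nat.eqb (col i) c) u))%nat).
        { induction u as [|i u IHu]; simpl; [lia|].
          destruct (Nat.ltb (col i) k); simpl; destruct (Nat.eqb (col i) c); simpl; lia. }
        apply F. }
    specialize (Hb k); nra.
Qed.

(** A color class of size [N ^ (5/6 + e)] would contain a hyperedge, so the classes are smaller and
    [k] of them must cover all [N] lines. *)
Lemma coloring_bound (L : list line) (e : R) :
  (1 <= length L)%nat ->
  (forall S : list nat, NoDup S -> (forall i, In i S -> (i < length L)%nat) ->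
     Rpower (INR (length L)) (5/6 + e) <= INR (length S) ->
     exists p, off_lines L p /\ hyperedge_in L p (fun i => In i S)) ->
  forall k col, proper_coloring L k col -> Rpower (INR (length L)) (1/6 - e) <= INR k.
Proof.
  intros N1 H k col [Hc Hm]; apply Rnot_lt_le; intros Hk.
  set (N := length L) in *.
  set (b := Rpower (INR N) (5/6 + e)) in *.
  assert (b0 : 0 < b) by apply exp_pos.
  assert (N0 : 0 < INR N) by (apply lt_0_INR; lia).
  assert (P : INR (length (seq 0 N)) <= INR k * b).
  { apply (filter_pigeonhole col); [lra | |].
    - intros i Hi; apply in_seq in Hi; apply Hc; lia.
    - intros c; apply Rnot_lt_le; intros Hlt.
      destruct (H (filter (fun i => Nat.eqb (col i) c) (seq 0 N))) as [p [off hyp]].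
      + apply NoDup_filter, seq_NoDup.
      + intros i Hi; apply filter_In in Hi; destruct Hi as [Hi _]; apply in_seq in Hi; lia.
      + lra.
      + apply (Hm p off); exists c; intros i Hi Hb.
        specialize (hyp i Hi Hb); apply filter_In in hyp; apply Nat.eqb_eq, hyp. }
  rewrite length_seq in P.
  assert (E : Rpower (INR N) (1/6 - e) * b = INR N).
  { unfold b; rewrite <- Rpower_plus.
    replace (1/6 - e + (5/6 + e)) with 1 by lra; apply Rpower_1; exact N0. }
  nra.
Qed.

Lemma NoDup_length_le (N : nat) (S : list nat) :
  NoDup S -> (forall i, In i S -> (i < N)%nat) -> (length S <= N)%nat.
Proof.
  intros nd HS; rewrite <- (length_seq N 0); apply NoDup_incl_length; [exact nd|].
  intros i Hi; apply in_seq; specialize (HS i Hi); lia.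
Qed.

Theorem theorem2p7 :
  exists eps : nat -> R, Un_cv eps 0 /\
  forall n : nat, exists L : list line,
    length L = n /\ simple_arr L /\
    (forall S : list nat, NoDup S -> (forall i, In i S -> (i < n)%nat) ->
       Rpower (INR n) (5/6 + eps n) <= INR (length S) ->
       exists p, off_lines L p /\ hyperedge_in L p (fun i => In i S)) /\
    (forall (k : nat) (col : nat -> nat), proper_coloring L k col ->
       Rpower (INR n) (1/6 - eps n) <= INR k).
Proof.
  destruct GridTriples.exact_triples as [c Hc].
  exists (fun N => ln (slack c N) / ln (INR N)); split; [apply slack_exponent_cv|].
  intros n; set (e := ln (slack c n) / ln (INR n)).
  cut (exists L, length L = n /\ simple_arr L /\
    (forall S : list nat, NoDup S -> (forall i, In i S -> (i < n)%nat) ->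
       Rpower (INR n) (5/6 + e) <= INR (length S) ->
       exists p, off_lines L p /\ hyperedge_in L p (fun i => In i S))).
  { intros (L & HL & simple & H); exists L; split; [exact HL|]; split; [exact simple|].
    split; [exact H|]; intros k col Hcol.
    destruct n as [|n].
    (* Without lines the only cell has an empty hyperedge, which is monochromatic, so no coloring is
       proper. *)
    - exfalso; destruct Hcol as [_ Hm].
      apply (Hm (0, 0)).
      + intros i Hi; rewrite HL in Hi; lia.
      + exists 0%nat; intros i Hi; rewrite HL in Hi; lia.
    - rewrite <- HL in H |- *; apply (coloring_bound L e) with (col := col); trivial.
      rewrite HL; lia. }
  (* For [n <= 1] the exponent [e] is not meaningful, but the power is still positive, so [S] is
     nonempty and can only be the single line. *)
  destruct (Nat.le_gt_cases n 1) as [Hn|Hn].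
  { destruct (exact_triple_cells n (fun i => (Z.of_nat i, 0, 0)%Z)) as (L & HL & simple & _).
    { intros i j _ _ E; injection E; lia. }
    exists L; split; [exact HL|]; split; [exact simple|].
    intros S nd HS big.
    destruct S as [|s S].
    { pose proof (exp_pos ((5/6 + e) * ln (INR n))); unfold Rpower in big; simpl in big; lra. }
    assert (n = 1%nat) as -> by (specialize (HS s (or_introl eq_refl)); lia).
    assert (s = 0%nat) as -> by (specialize (HS s (or_introl eq_refl)); lia).
    assert (exists p, ~ on_line (lin L 0) p) as [p Hp].
    { pose proof (line_nondeg (lin L 0)) as nz.
      destruct (classic (on_line (lin L 0) (0, 0))) as [h|h]; [|eauto].
      exists (la (lin L 0), lb (lin L 0)); unfold on_line in *; simpl in *; nra. }
    exists p; split.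
    - intros i; rewrite HL; intros Hi; replace i with 0%nat by lia; exact Hp.
    - intros i; rewrite HL; intros Hi _; left; lia. }
  assert (n0 : 1 < INR n) by (change 1 with (INR 1); apply lt_INR; lia).
  assert (lnn : 0 < ln (INR n)) by (rewrite <- ln_1; apply ln_increasing; lra).
  pose proof (slack_ge c n) as sl.
  assert (E : Rpower (INR n) (5/6 + e) = slack c n * Rpower (INR n) (5/6)).
  { rewrite Rpower_plus, Rmult_comm; f_equal; unfold Rpower, e.
    unfold Rdiv; rewrite Rmult_assoc, Rinv_l, Rmult_1_r by lra; apply exp_ln; lra. }
  rewrite E.
  destruct (Nat.le_gt_cases 4 n) as [Hn4|Hn4].
  - destruct (parameters c n Hn4) as (q & l & l1 & hq & hN & hm).
    destruct (Hc q l n ltac:(lia) l1 hq hN) as (P & inj & HP).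
    destruct (exact_triple_cells n P inj) as (L & HL & simple & cells).
    exists L; split; [exact HL|]; split; [exact simple|].
    intros S nd HS big.
    destruct (HP S nd HS) as (i & j & k & iS & jS & kS & ij & jk & ik & col & excl).
    { apply INR_le, (Rle_trans _ _ _ hm big). }
    destruct (cells i j k) as (p & off & hyp); auto.
    exists p; split; [exact off|]; apply hyp; assumption.
  (* For two or three lines the threshold is at least [512], more than the size of any [S]. *)
  - destruct (exact_triple_cells n (fun i => (Z.of_nat i, 0, 0)%Z)) as (L & HL & simple & _).
    { intros i j _ _ E'; injection E'; lia. }
    exists L; split; [exact HL|]; split; [exact simple|].
    intros S nd HS big; exfalso.
    assert (INR (length S) <= 4).
    { replace 4 with (INR 4) by (simpl; lra); apply le_INR.
      pose proof (NoDup_length_le n S nd HS); lia. }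
    assert (1 <= Rpower (INR n) (5/6)).
    { rewrite <- (Rpower_O (INR n)) at 1 by lra; apply Rle_Rpower; lra. }
    nra.
Qed.
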